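(* Let $\Omega\subset\mathbf{R}^N$ be a bounded open set with boundary $\Gamma$, let $\lambda_1>0$ be the first eigenvalue of the Laplacian (i.e. of $-\Delta$) in $\Omega$ with zero boundary condition on $\Gamma$, and let $\sigma(\mathbf{x},t)$ be a continuous positive function on $\Omega\times(0,\infty)$ such that $$0<\sigma_0\le\sigma(\mathbf{x},t)\le\sigma_1<\infty,\qquad \sigma_0=\inf_{\Omega\times(0,\infty)}\sigma,\quad \sigma_1=\sup_{\Omega\times(0,\infty)}\sigma .$$ Let $u(\mathbf{x},t)$ be a regular (classical) solution of the initial-boundary value problem $$u_{tt}-\Delta u+\sigma(\mathbf{x},t)u_t=0\ \text{ in }\Omega\times(0,\infty),\qquad u=0\ \text{ on }\Gamma\times[0,\infty),$$ $$u(\mathbf{x},0)=u_0(\mathbf{x}),\quad u_t(\mathbf{x},0)=u_1(\mathbf{x})\ \text{ for }\mathbf{x}\in\Omega .$$ For $\epsilon\in\mathbf{R}$ define $$F(\epsilon,\sigma_0,\sigma_1,\lambda_1)=\frac{\sigma_0}{2}-\frac{\sqrt{(\sigma_0-2\epsilon)^2\lambda_1^2+\epsilon^2(\sigma_1-\epsilon)^2\lambda_1}}{2\lambda_1},$$ let $\epsilon^*$ be a point of absolute maximum of $\epsilon\mapsto F(\epsilon,\sigma_0,\sigma_1,\lambda_1)$ on $\mathbf{R}$, and let $\alpha^*=F(\epsilon^*,\sigma_0,\sigma_1,\lambda_1)$. Then $\alpha^*>0$ and, for all $t\ge 0$, $$\int_\Omega|\nabla u(\mathbf{x},t)|^2\,dx\le\left(\int_\Omega\left(|\nabla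 u_0(\mathbf{x})|^2+|u_1(\mathbf{x})+\epsilon^*u_0(\mathbf{x})|^2\right)dx\right)e^{-2\alpha^*t}.$$ In particular, the energy $\int_\Omega|\nabla u(\mathbf{x},t)|^2dx$ decays exponentially as $t\to\infty$.
   Context: $\nabla$ and $\Delta$ are taken with respect to the space variable $\mathbf{x}\in\mathbf{R}^N$. The functions $u,u_0,u_1,\sigma$ are real-valued. The data $u_0,u_1$ satisfy the usual regularity and compatibility conditions implied by the assumption that $u$ is a regular (classical) solution; here a regular (classical) solution means a function $u\in C^2(\overline{\Omega}\times[0,\infty))$ satisfying the equation, the boundary condition and the initial conditions pointwise. The first eigenvalue is characterized by the Poincaré inequality: $\lambda_1$ is the largest constant with $\lambda_1\int_\Omega w^2dx\le\int_\Omega|\nabla w|^2dx$ for all $w\in H_0^1(\Omega)$. *)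

(* Defs.v *)
From HB Require Import structures.
From mathcomp Require Import all_boot all_order all_algebra.
From mathcomp Require Import all_classical all_reals all_analysis.

Set Implicit Arguments.
Unset Strict Implicit.
Unset Printing Implicit Defensive.
Import Order.TTheory GRing.Theory Num.Theory.
Import numFieldNormedType.Exports.

Local Open Scope classical_set_scope.
Local Open Scope ring_scope.

(* The sigma-algebra on row vectors generated by the coordinates, as for
   tuples.  Over the reals it is the Borel sigma-algebra of R^n. *)
Definition measure_rV_display : measure_display -> measure_display.
Proof. exact. Qed.

Section measurable_rV.
Context {d} {T : measurableType d}.
Variable n : nat.

Let coors : 'I_n -> 'rV[T]_n -> T := fun i x => x ord0 i.

Let rV_set0 : g_sigma_preimage coors set0.
Proof. exact: sigma_algebra0. Qed.

Let rV_setC A : g_sigma_preimage coors A -> g_sigma_preimage coors (~` A).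
Proof. exact: sigma_algebraC. Qed.

Let rV_bigcup (F : _^nat) : (forall i, g_sigma_preimage coors (F i)) ->
  g_sigma_preimage coors (\bigcup_i (F i)).
Proof. exact: sigma_algebra_bigcup. Qed.

HB.instance Definition _ := @isMeasurable.Build (measure_rV_display d)
  'rV[T]_n (g_sigma_preimage coors) rV_set0 rV_setC rV_bigcup.

End measurable_rV.

Lemma measurable_coord_rV d (T : measurableType d) n (i : 'I_n) :
  measurable_fun [set: 'rV[T]_n] (fun x : 'rV[T]_n => x ord0 i).
Proof.
move=> _ Y mY; rewrite setTI; apply: sub_sigma_algebra => /=.
rewrite -bigcup_seq/=; exists i => /=; first by rewrite mem_index_enum.
by exists Y => //; rewrite setTI.
Qed.

Lemma measurable_fun_rVP d1 d2 (T1 : measurableType d1) (T2 : measurableType d2)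
    n (f : T1 -> 'rV[T2]_n) :
  (forall i, measurable_fun [set: T1] (fun x => f x ord0 i)) ->
  measurable_fun [set: T1] f.
Proof.
move=> mf.
suff prefS : g_sigma_preimage (fun i x => f x ord0 i) `<=` measurable.
  move=> _ A mA; apply: prefS.
  rewrite (g_sigma_preimage_comp (fun (i : 'I_n) (x : 'rV[T2]_n) => x ord0 i)).
  by exists A.
apply: smallest_sub; first exact: sigma_algebra_measurable.
case: n => [|n] in f mf *; first by rewrite big_ord0.
rewrite -bigcup_mkord_ord; apply: bigcup_sub => i Ii.
by move=> A [B mB <-]; exact: mf.
Qed.

Section lebesgue_rV.
Context {R : realType}.

(* (a, y) |-> (a, y_0, ..., y_(n-1)) *)
Definition consV n (p : R * 'rV[R]_n) : 'rV[R]_n.+1 :=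
  \row_i oapp (p.2 ord0) p.1 (unlift ord0 i).

Lemma measurable_consV n : measurable_fun [set: R * 'rV[R]_n] (@consV n).
Proof.
apply: measurable_fun_rVP => i; rewrite /consV.
under eq_fun do rewrite mxE.
case: unliftP => [j _|_] /=; last exact: measurable_fst.
apply: (@measurableT_comp _ _ _ _ _ _ (fun x : 'rV[R]_n => x ord0 j)) => //.
exact: measurable_coord_rV.
Qed.

Let unconsV n (x : 'rV[R]_n.+1) : R * 'rV[R]_n :=
  (x ord0 ord0, \row_j x ord0 (lift ord0 j)).

Let consVK n : cancel (@consV n) (@unconsV n).
Proof.
case=> a y; rewrite /unconsV /consV mxE unlift_none /=; congr pair.
by apply/rowP => j; rewrite !mxE liftK.
Qed.

Let measurable_unconsV n : measurable_fun [set: 'rV[R]_n.+1] (@unconsV n).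
Proof.
apply/measurable_fun_pairP; split; first exact: measurable_coord_rV.
apply: measurable_fun_rVP => i /=.
by under eq_fun do rewrite mxE; exact: measurable_coord_rV.
Qed.

Section succ.
Variables (n : nat) (mu : {sigma_finite_measure set 'rV[R]_n -> \bar R}).

Definition lebesgue_rV_succ : set 'rV[R]_n.+1 -> \bar R :=
  pushforward (lebesgue_measure \x mu)%E (@consV n).

Let succ0 : lebesgue_rV_succ set0 = 0%E.
Proof. by rewrite /lebesgue_rV_succ/= /pushforward preimage_set0 measure0. Qed.

Let succ_ge0 A : (0 <= lebesgue_rV_succ A)%E.
Proof. exact: (measure_ge0 (lebesgue_measure \x mu)%E (@consV n @^-1` A)). Qed.

Let succ_sigma_additive : semi_sigma_additive lebesgue_rV_succ.
Proof.
apply: (@measure_semi_sigma_additive _ _ _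
  (pushforward (lebesgue_measure \x mu)%E (@consV n))).
exact: measurable_consV.
Qed.

HB.instance Definition _ := isMeasure.Build _ _ _ lebesgue_rV_succ
  succ0 succ_ge0 succ_sigma_additive.

Let succ_sigma_finite : sigma_finite setT lebesgue_rV_succ.
Proof.
have /sigma_finiteP[F [TF ndF Foo]] := sigma_finiteT (@lebesgue_measure R).
have /sigma_finiteP[G [TG ndG Goo]] := sigma_finiteT mu.
exists (fun k => @unconsV n @^-1` (F k `*` G k)).
  apply/seteqP; split=> // x _.
  have [k _ Fk] : (\bigcup_k F k) (unconsV x).1 by rewrite -TF.
  have [l _ Gl] : (\bigcup_k G k) (unconsV x).2 by rewrite -TG.
  exists (maxn k l) => //; split.
  - by move: Fk; exact/subsetPset/ndF/leq_maxl.
  - by move: Gl; exact/subsetPset/ndG/leq_maxr.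
move=> k; have [mF Fk] := Foo k; have [mG Gk] := Goo k; split.
  by rewrite -[X in measurable X]setTI; apply: measurable_unconsV => //;
    exact: measurableX.
rewrite /lebesgue_rV_succ /pushforward -comp_preimage.
have -> : @unconsV n \o @consV n = id by apply/funext => p; exact: consVK.
by rewrite preimage_id product_measure1E// lte_mul_pinfty// ge0_fin_numE.
Qed.

HB.instance Definition _ := Measure_isSigmaFinite.Build _ _ _ lebesgue_rV_succ
  succ_sigma_finite.

End succ.

(* Lebesgue measure on R^n; R^0 is a point, of measure one. *)
Fixpoint lebesgue_rV n : {sigma_finite_measure set 'rV[R]_n -> \bar R} :=
  match n with
  | 0 => \d_(0 : 'rV[R]_0)
  | n'.+1 => lebesgue_rV_succ (lebesgue_rV n')
  end.

Lemma lebesgue_rV_box n (A : 'I_n -> set R) :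
  (forall i, measurable (A i)) ->
  lebesgue_rV n [set x | forall i, A i (x ord0 i)] =
  (\prod_(i < n) lebesgue_measure (A i))%E.
Proof.
elim: n A => [|n IHn] A mA.
  by rewrite big_ord0 /= diracE mem_set// => -[].
rewrite big_ord_recl -IHn => [|i]; last exact: mA.
have mB : measurable [set y : 'rV[R]_n | forall i, A (lift ord0 i) (y ord0 i)].
  rewrite (_ : [set y | _] =
      \big[setI/setT]_i ((fun y : 'rV[R]_n => y ord0 i) @^-1` A (lift ord0 i))).
    apply: bigsetI_measurable => i _.
    by rewrite -[X in measurable X]setTI; exact: measurable_coord_rV.
  rewrite -bigcap_seq; apply/seteqP; split => y /= Ay i.
    by move=> _; exact: (Ay i).
  exact: (Ay i (mem_index_enum i)).
rewrite -product_measure1E//; last exact: mA.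
transitivity ((lebesgue_measure \x lebesgue_rV n)%E
  (@consV n @^-1` [set x | forall i, A i (x ord0 i)])) => //.
congr (product_measure1 _ _ _).
apply/seteqP; split=> -[a y] /=.
  move=> Ap; split => [|i].
    by have := Ap ord0; rewrite mxE unlift_none.
  by have := Ap (lift ord0 i); rewrite mxE liftK.
move=> [Aa Ay] i; rewrite mxE; case: unliftP => [j ->|->] //=.
Qed.

End lebesgue_rV.

Section calculus.
Context {R : realType}.

(* f is of class C^k up to the boundary of the open set A: all directional
   derivatives of order at most k exist in A and extend continuously to the
   closure of A.  On the closure f itself is the continuous extension; its
   derivatives are extended by the functions g. *)
Fixpoint Ck_closure (k : nat) (V : normedModType R) (A : set V) (f : V -> R) :
    Prop :=
  {within closure A, continuous f} /\
  match k with
  | 0 => True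
  | k'.+1 => forall v : V,
      exists2 g : V -> R, (forall z, A z -> is_derive z v f (g z)) &
                          Ck_closure k' A g
  end.

Variable n : nat.
Implicit Types (f w : 'rV[R]_n -> R) (g : 'I_n -> 'rV[R]_n -> R).
Implicit Types Omega : set 'rV[R]_n.

Definition partial (i : 'I_n) f : 'rV[R]_n -> R := 'D_(delta_mx ord0 i) f.

Definition gradsq f (x : 'rV[R]_n) : R := \sum_(i < n) partial i f x ^+ 2.

Definition laplacian f (x : 'rV[R]_n) : R :=
  \sum_(i < n) partial i (partial i f) x.

Definition boundary Omega : set 'rV[R]_n := closure Omega `\` interior Omega.

(* The space-time domain of the equation, with closure
   closure Omega `*` `[0, +oo[. *)
Definition cylinder Omega : set ('rV[R]_n * R) := Omega `*` `]0, +oo[.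

Definition C1c Omega f : Prop :=
  let supp := closure [set x | f x != 0] in
  [/\ Ck_closure 1 setT f, compact supp & supp `<=` Omega].

Definition sqint Omega f : \bar R :=
  (\int[lebesgue_rV n]_(x in Omega) (f x ^+ 2)%:E)%E.

Definition in_L2 Omega f : Prop :=
  measurable_fun Omega f /\ (sqint Omega f < +oo)%E.

(* w belongs to H^1_0(Omega), the closure of C^1_c(Omega) in H^1(Omega), and g is
   its weak gradient: an L^2 limit of gradients of functions converging to w
   in L^2 is the weak gradient of w.  (Starting from smooth compactly supported
   functions gives the same space.) *)
Definition H10 Omega w g : Prop :=
  [/\ in_L2 Omega w,
      forall i, in_L2 Omega (g i) &
      exists phi : nat -> 'rV[R]_n -> R,
        [/\ forall k, C1c Omega (phi k),
            sqint Omega (fun x => phi k x - w x) @[k --> \oo] --> 0%E &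
            forall i,
              sqint Omega (fun x => partial i (phi k) x - g i x) @[k --> \oo]
                --> 0%E]].

Definition poincare Omega (lambda : R) : Prop :=
  forall w g, H10 Omega w g ->
    (lambda%:E * sqint Omega w <=
     \int[lebesgue_rV n]_(x in Omega) (\sum_(i < n) g i x ^+ 2)%:E)%E.

(* First eigenvalue of the Dirichlet Laplacian: the largest constant in the
   Poincare inequality. *)
Definition first_eigenvalue Omega (lambda1 : R) : Prop :=
  poincare Omega lambda1 /\
  forall lambda, poincare Omega lambda -> lambda <= lambda1.

End calculus.

Definition decayF {R : realType} (eps sigma0 sigma1 lambda1 : R) : R :=
  sigma0 / 2 -
  Num.sqrt ((sigma0 - 2 * eps) ^+ 2 * lambda1 ^+ 2 +
            eps ^+ 2 * (sigma1 - eps) ^+ 2 * lambda1) / (2 * lambda1).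

(* Main.v *)
Require Import Defs.
From HB Require Import structures.
From mathcomp Require Import all_boot all_order all_algebra.
From mathcomp Require Import all_classical all_reals all_analysis.
From mathcomp Require Import measurable_realfun ring lra.

Set Implicit Arguments.
Unset Strict Implicit.
Unset Printing Implicit Defensive.
Import Order.TTheory GRing.Theory Num.Theory.
Import numFieldNormedType.Exports.

Local Open Scope classical_set_scope.
Local Open Scope ring_scope.

(** The solution is studied through the perturbed energy
    [E t = \int (|grad u|^2 + v^2)] with [v = u_t + eps u]. Write [G] for the
    integral of [|grad u|^2]. Differentiating under the integral and using the
    equation, the terms that contain [grad u . grad v + v Delta u] form the
    divergence of [v grad u] and integrate to 0, since [v] vanishes on the
    boundary. What remains is
    [E' / 2 = - eps G - \int (sigma - eps) v (v - eps u)].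
    With [alpha = decayF eps] and [0 < eps <= sigma0], the pointwise inequality
    [(sigma - eps) v (v - eps u) >= alpha v^2 - (eps - alpha) lambda1 u^2]
    holds ([decayF_form]), because [alpha] is the smaller eigenvalue of the
    quadratic form obtained by taking [sigma] at its least favourable values.
    The Poincare inequality bounds [lambda1 \int u^2] by [G], hence
    [E' <= - 2 alpha E], and [E t * exp (2 alpha t)] is nonincreasing
    ([energy_decay]). For small [eps > 0] the rate is positive
    ([decayF_gt0_exists]), so the maximal rate is positive, and this forces
    [0 < eps_star < sigma0] ([decayF_gt0_eps]).

    The boundary of [Omega] is arbitrary, which determines how three steps are
    carried out. The divergence is integrated coordinate by coordinate on lines,
    where an open set is a disjoint union of intervals
    ([integral_vanishing_primitive]). The Poincare inequality reaches the
    solution by truncating its small values ([poincare_C1]). Finally, [u_t = 0]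
    on the lateral boundary, and the identification of the derivatives at time 0
    with their limits from positive times, come from the mean value theorem on
    segments inside the cylinder ([right_derivative_closure]). *)

(** * Measurability and integrability on R^n *)

Lemma coord_le_norm (R : realType) n (x : 'rV[R]_n) i : `|x ord0 i| <= `|x|.
Proof.
rewrite [leRHS]/Num.norm /= mx_normrE.
exact: (@le_bigmax _ _ _ 0 (fun ij => `|x ij.1 ij.2|) (ord0, i)).
Qed.

Lemma ball_rV_box (R : realType) n (x : 'rV[R]_n) (e : R) : 0 < e ->
  ball x e = [set y | forall i, `](x ord0 i - e), (x ord0 i + e)[%classic (y ord0 i)].
Proof.
move=> e0; apply/seteqP; split => y /=.
  case=> _ xy i; rewrite in_itv /= -ltr_distlC distrC.
  by have := xy ord0 i; rewrite /ball /= distrC.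
move=> xy; split => // i j; rewrite (ord1 i).
by have := xy j; rewrite in_itv /= -ltr_distlC /ball /= distrC.
Qed.

Lemma measurable_box_rV (R : realType) n (A : 'I_n -> set R) :
  (forall i, measurable (A i)) ->
  measurable [set x : 'rV[R]_n | forall i, A i (x ord0 i)].
Proof.
move=> mA.
rewrite (_ : [set y | _] =
    \big[setI/setT]_i ((fun y : 'rV[R]_n => y ord0 i) @^-1` A i)).
  apply: bigsetI_measurable => i _.
  by rewrite -[X in measurable X]setTI; exact: measurable_coord_rV.
rewrite -bigcap_seq; apply/seteqP; split => y /= Ay i.
  by move=> _; exact: (Ay i).
exact: (Ay i (mem_index_enum i)).
Qed.

(** The sigma-algebra generated by the coordinates contains the open sets: an
    open set is a countable union of cubes with rational centres. *)
Lemma open_measurable_rV (R : realType) n (U : set 'rV[R]_n) :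
  open U -> measurable U.
Proof.
move=> oU.
pose B (p : 'rV[rat]_n * nat) : set 'rV[R]_n :=
  ball (map_mx ratr p.1 : 'rV[R]_n) (p.2.+1%:R^-1).
pose F p := if pselect (B p `<=` U) then B p else set0.
have -> : U = \bigcup_p F p.
  apply/seteqP; split => [x Ux|x [p _]]; last first.
    by rewrite /F; case: pselect => // BU; exact: BU.
  have := oU; rewrite openE => /(_ _ Ux); rewrite /interior /= -nbhs_ballE.
  case=> e /= e0 xeU.
  have [k ke] : exists k : nat, k.+1%:R^-1 < e / 2.
    exists (Num.truncn (e / 2)^-1); rewrite invf_plt ?posrE ?ltr0n ?divr_gt0//.
    by rewrite truncnS_gt.
  have /choice[q hq] : forall i : 'I_n, exists q : rat,
      x ord0 i - k.+1%:R^-1 < ratr q < x ord0 i + k.+1%:R^-1.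
    move=> i; have [|q] := @rat_in_itvoo R (x ord0 i - k.+1%:R^-1) (x ord0 i + k.+1%:R^-1).
      by rewrite ltrD2l gtrN// invr_gt0.
    by rewrite in_itv /= => ?; exists q.
  have xB : B (\row_i q i, k) x.
    split; first by rewrite invr_gt0.
    move=> i j; rewrite (ord1 i) !mxE /ball/= distrC ltr_distlC.
    by have := hq j.
  exists (\row_i q i, k) => //; rewrite /F; case: pselect => // -[] y By.
  apply: xeU; apply: (@ball_splitr _ _ (map_mx ratr (\row_i q i) : 'rV[R]_n)).
    exact: (le_ball (ltW ke) xB).
  exact: (le_ball (ltW ke) By).
apply: countable_bigcupT_measurable => [|p]; first exact: countableP.
rewrite /F; case: (pselect _) => [?|?] //=.
rewrite /B ball_rV_box ?invr_gt0//.
pose c : 'rV[R]_n := map_mx ratr p.1.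
by apply: (@measurable_box_rV R n
  (fun i => `](c ord0 i - p.2.+1%:R^-1), (c ord0 i + p.2.+1%:R^-1)[%classic)).
Qed.

Lemma measurable_fun_within_rV (R : realType) n (D : set 'rV[R]_n)
    (f : 'rV[R]_n -> R) :
  measurable D -> {within D, continuous f} -> measurable_fun D f.
Proof.
move=> mD /continuousP cf; apply: (measurability _ (measurable_realfun.RGenOpens.measurableE R)).
move=> _ [_ [a [b ->] <-]].
have /open_subspaceP[V oV VD] := cf _ (@interval_open _ (BRight a) (BLeft b) isT isT).
by rewrite setIC -VD; apply: measurableI => //; exact: open_measurable_rV.
Qed.

Lemma bounded_rV_fin (R : realType) n (A : set 'rV[R]_n) :
  bounded_set A -> measurable A -> (lebesgue_rV n A < +oo)%E.
Proof.
move=> [M [Mreal MA]] mA.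
have {}MA x : A x -> forall i, `[(- (`|M| + 1)), (`|M| + 1)]%classic (x ord0 i).
  move=> Ax i; rewrite /= in_itv/= -ler_norml.
  have /MA/(_ _ Ax) : M < `|M| + 1 by rewrite ltr_pwDr// ler_norm.
  exact: le_trans (coord_le_norm _ _).
apply: (@le_lt_trans _ _ (lebesgue_rV n
    [set x | forall i, `[(- (`|M| + 1)), (`|M| + 1)]%classic (x ord0 i)])).
  apply: le_measure; rewrite ?inE//.
  exact: (@measurable_box_rV R n (fun=> `[(- (`|M| + 1)), (`|M| + 1)]%classic)).
rewrite (@lebesgue_rV_box R n (fun=> `[(- (`|M| + 1)), (`|M| + 1)]%classic))//.
under eq_bigr do rewrite lebesgue_measure_itv /= -EFinD -(fun_if EFin).
by rewrite prodEFin ltry.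
Qed.

Lemma bounded_set_closure (R : realType) (V : normedModType R) (A : set V) :
  bounded_set A -> bounded_set (closure A).
Proof.
case=> M [Mr MA]; exists (M + 1 + 1); split; first exact: num_real.
move=> y My x /= clAx.
have [z [Az]] := clAx _ (nbhsx_ballx x _ (@ltr01 R)).
rewrite -ball_normE /= => xz.
have zM : `|z| <= M + 1 by apply: MA => //; rewrite ltrDl.
rewrite (le_trans _ (ltW My))// -(subrK z x) (le_trans (ler_normD _ _))//.
by rewrite addrC lerD// ltW.
Qed.

Lemma compact_closure_rV (R : realType) n (A : set 'rV[R]_n) :
  bounded_set A -> compact (closure A).
Proof.
by move=> bA; apply: bounded_closed_compact;
  [exact: bounded_set_closure|exact: closed_closure].
Qed.

Lemma within_continuous_compact_bounded (R : realType) (V : topologicalType)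
    (K : set V) (f : V -> R) :
  compact K -> {within K, continuous f} ->
  exists2 M, 0 <= M & forall x, K x -> `|f x| <= M.
Proof.
move=> cK cf.
have [M [_ MA]] := compact_bounded (continuous_compact cf cK).
exists (`|M| + 1); first by rewrite addr_ge0.
move=> x Kx; apply: (MA (`|M| + 1)); first by rewrite ltr_pwDr// ler_norm.
by exists x.
Qed.

Lemma integrable_rV_bounded (R : realType) n (A : set 'rV[R]_n)
    (f : 'rV[R]_n -> R) (M : R) :
  bounded_set A -> measurable A -> measurable_fun A f ->
  (forall x, A x -> `|f x| <= M) -> (lebesgue_rV n).-integrable A (EFin \o f).
Proof.
move=> bA mA mf fM; apply: measurable_bounded_integrable => //.
  exact: bounded_rV_fin.
by exists M; split; [exact: num_real|move=> y My x Ax; exact: le_trans (fM _ Ax) (ltW My)].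
Qed.

Lemma integrable_rV_closure (R : realType) n (Omega : set 'rV[R]_n)
    (f : 'rV[R]_n -> R) :
  open Omega -> bounded_set Omega -> {within closure Omega, continuous f} ->
  (lebesgue_rV n).-integrable Omega (EFin \o f).
Proof.
move=> oO bO cf.
have [M _ fM] := within_continuous_compact_bounded (compact_closure_rV bO) cf.
apply: (integrable_rV_bounded (M := M)) => //.
- exact: open_measurable_rV.
- apply: measurable_fun_within_rV; first exact: open_measurable_rV.
  by apply: continuous_subspaceW cf; exact: subset_closure.
- by move=> x Ox; apply: fM; exact: subset_closure.
Qed.

(** * Integration by parts on a bounded open set *)

(** An affine reparametrization transports directional derivatives; the
    linear part is only required to send [w] to [v]. *)
Lemma is_derive_affine (R : realType) (U V : normedModType R) (L : U -> V)
    (w : U) (v : V) (z : U) (f : V -> R) (l : R) :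
  (forall h : R, L (h *: w + z) = h *: v + L z) ->
  is_derive (L z) v f l -> is_derive z w (f \o L) l.
Proof.
move=> Lh [df dfl].
have E : (fun h : R => h^-1 *: ((f \o L) (h *: w + z) - (f \o L) z)) =
         (fun h : R => h^-1 *: (f (h *: v + L z) - f (L z))).
  by apply/funext => h /=; rewrite Lh.
apply: DeriveDef; first by rewrite /derivable E.
by rewrite -dfl /derive E.
Qed.

(** A function [W] with directional derivative [g] along [v] in a bounded open
    set, both continuous up to the boundary, with [W] zero on the boundary. *)
Definition vanishing_primitive (R : realType) (V : normedModType R)
    (Omega : set V) (v : V) (W g : V -> R) : Prop :=
  [/\ open Omega, bounded_set Omega,
      {within closure Omega, continuous W},
      {within closure Omega, continuous g} &
      (forall x, Omega x -> is_derive x v W (g x)) /\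
      (forall x, closure Omega x -> ~ Omega x -> W x = 0)].

Lemma closure_preimage (T U : topologicalType) (L : T -> U) (A : set U) :
  continuous L -> closure (L @^-1` A) `<=` L @^-1` closure A.
Proof.
move=> cL x clx B nB.
by have [y [Ay By]] := clx _ (cL x _ nB); exists (L y).
Qed.

Lemma within_continuous_comp (T U W : topologicalType) (L : T -> U) (A : set T)
    (B : set U) (f : U -> W) :
  continuous L -> A `<=` L @^-1` B -> {within B, continuous f} ->
  {within A, continuous (f \o L)}.
Proof.
move=> cL AB /subspace_continuousP cf; apply/subspace_continuousP => x Ax.
apply: (cvg_comp _ _ _ (cf (L x) (AB _ Ax))).
move=> P /= nP; have := cL x _ nP; rewrite /nbhs/=; rewrite /within /=.
by move=> nP'; near=> y => Ay; have : B (L y) := AB _ Ay; near: y.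
Unshelve. all: end_near. Qed.

(** The hypotheses pass to affine slices, which makes the integration by parts
    below provable by induction on the dimension. *)
Lemma vanishing_primitive_slice (R : realType) (U V : normedModType R)
    (L : U -> V) (w : U) (v : V) (Omega : set V) (W g : V -> R) :
  continuous L -> (forall z, `|z| <= `|L z|) ->
  (forall z (h : R), L (h *: w + z) = h *: v + L z) ->
  vanishing_primitive Omega v W g ->
  vanishing_primitive (L @^-1` Omega) w (W \o L) (g \o L).
Proof.
move=> cL nL Lh [oO bO cW cg [dW W0]]; split.
- by move/continuousP : cL; apply.
- case: bO => M [Mr MO]; exists M; split => // y My x Ox.
  exact: le_trans (nL _) (MO _ My _ Ox).
- by apply: within_continuous_comp cW => //; exact: closure_preimage.
- by apply: within_continuous_comp cg => //; exact: closure_preimage.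
- split => [x Ox|x clx Ox]; first by apply: is_derive_affine (dW _ Ox) => h.
  by apply: W0 => //; exact: closure_preimage clx.
Qed.

(** On the line, the open set is a countable disjoint union of intervals whose
    end points lie on the boundary, and the fundamental theorem of calculus
    applies on each of them. *)
Lemma integral_vanishing_primitive1 (R : realType) (O : set R) (W g : R -> R) :
  vanishing_primitive O 1 W g ->
  (\int[lebesgue_measure]_(x in O) (g x)%:E = 0)%E.
Proof.
move=> [oO bO cW cg [dW W0]].
have [M OM] : exists M, forall x, closure O x -> `|x| <= M.
  have [M [_ bM]] := bounded_set_closure bO.
  by exists (`|M| + 1) => x; apply: bM; rewrite ltr_pwDr// ler_norm.
have cO : compact (closure O).
  apply: (@subclosed_compact _ _ `[(- M), M]); first exact: closed_closure.
    exact: segment_compact.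
  by move=> x /OM; rewrite /= in_itv/= -ler_norml.
have mO := open_measurable oO.
have mg : measurable_fun O g.
  apply: subspace_continuous_measurable_fun => //.
  by apply: continuous_subspaceW cg; exact: subset_closure.
have intg : lebesgue_measure.-integrable O (EFin \o g).
  have [B _ gB] := within_continuous_compact_bounded cO cg.
  apply: measurable_bounded_integrable => //.
    apply: (@le_lt_trans _ _ (lebesgue_measure `[(- M), M]%classic)).
      apply: le_measure; rewrite ?inE// => x Ox.
      by rewrite /= in_itv/= -ler_norml; apply: OM; exact: subset_closure.
    by rewrite lebesgue_measure_itv/=; case: ifP; rewrite ?ltry.
  exists B; split; first exact: num_real.
  by move=> y By x Ox; apply: le_trans (ltW By); apply: gB; exact: subset_closure.
have UO := open_disjoint_itv_bigcup oO.
rewrite [X in integral _ X]UO integral_bigcup//.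
- apply: eseries0 => k _ _.
  set J := open_disjoint_itv oO k.
  have JO : J `<=` O by rewrite UO => x Ix; exists k.
  have oJ : open J by exact: open_disjoint_itv_open.
  have [->|/set0P[c Jc]] := eqVneq J set0; first by rewrite integral_set0.
  have lJ : has_lbound J.
    exists (- M) => x /JO/subset_closure/OM; rewrite ler_norml => /andP[]//.
  have uJ : has_ubound J.
    exists M => x /JO/subset_closure/OM; rewrite ler_norml => /andP[]//.
  have iJ := @open_disjoint_itv_is_interval _ _ oO k.
  have := interval_bounded_interior iJ lJ uJ.
  move: (oJ) => /interior_id ->; rewrite -/J.
  move: (inf J) (sup J) => a b JE.
  have {}JE : J = `]a, b[%classic by rewrite JE; apply/seteqP; split=> x; rewrite /= in_itv.
  have ab : a < b by move: Jc; rewrite JE/= in_itv/= => /andP[]; exact: lt_trans.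
  have clabJ : `[a, b] `<=` closure J.
    move=> z; rewrite /= in_itv/= => /andP[az zb] B nB.
    have zt : z + t * (c - z) @[t --> (0:R)^'+] --> z.
      rewrite [X in _ --> X](_ : z = z + 0 * (c - z)); last by rewrite mul0r addr0.
      apply: cvgD; first exact: cvg_cst.
      by apply: cvgM; [exact/cvg_within|exact: cvg_cst].
    have [t [[Bt t0] t1]] : exists t, (B (z + t * (c - z)) /\ 0 < t) /\ t < 1.
      apply: (@filter_ex _ (0:R)^'+); near=> t; split; [split|].
      - by near: t; exact: zt.
      - by near: t; exact: nbhs_right_gt.
      - by near: t; exact: nbhs_right_lt.
    exists (z + t * (c - z)); split => //.
    move: Jc; rewrite JE /= !in_itv/= => /andP[ac cb].
    by apply/andP; split; nra.
  have clab : `[a, b] `<=` closure O by move=> z /clabJ; exact: closureS.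
  (* An end point of [J] in [O] would belong to another component, which is
     open and hence meets [J]. *)
  have notO z : ~ J z -> closure J z -> ~ O z.
    move=> nJz clJz; rewrite UO => -[j _ Jjz].
    have := clJz _ (open_nbhs_nbhs (conj (@open_disjoint_itv_open _ _ oO j) Jjz)).
    move=> /(open_disjoint_itv_trivIset (oU := oO) I I) kj.
    by apply: nJz; rewrite /J kj.
  have Wa z : `[a, b]%classic z -> ~ `]a, b[%classic z -> W z = 0.
    move=> /clabJ clz nz; apply: W0; last by apply: notO; rewrite // JE.
    exact: closureS clz.
  have cgab := continuous_subspaceW clab cg.
  have cWab := continuous_subspaceW clab cW.
  have dWab x : x \in `]a, b[ -> is_derive x 1 W (g x).
    by move=> xab; apply: dW; apply: JO; rewrite JE.
  rewrite JE -(@integral_itv_bndoo _ _ _ _ true false); last first.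
    apply/measurable_EFinP; apply: measurable_funS mg => //.
    by rewrite -JE.
  rewrite (@continuous_FTC2 _ _ W)//.
  - rewrite !Wa ?sube0//= ?in_itv/= ?lexx ?ltxx ?andbF ?(ltW ab)//.
  - have [_ Wa' Wb'] := (continuous_within_itvP W ab).1 cWab.
    by split=> // x /dWab[].
  - by move=> x /dWab dx; rewrite derive1E derive_val.
- exact: open_disjoint_itv_trivIset.
- by move=> k; apply: open_measurable; exact: open_disjoint_itv_open.
- by rewrite -UO.
Unshelve. all: end_near. Qed.

Section consV_slices.
Context {R : realType}.
Variable n : nat.

Lemma le_norm_consV1 (y : 'rV[R]_n) (a : R) : `|a| <= `|consV (a, y)|.
Proof. by have := coord_le_norm (consV (a, y)) ord0; rewrite mxE unlift_none. Qed.

Lemma le_norm_consV2 (a : R) (y : 'rV[R]_n) : `|y| <= `|consV (a, y)|.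
Proof.
rewrite [leLHS]/Num.norm /= mx_normrE.
apply/bigmax_leP; split => //= -[i j] _ /=; rewrite (ord1 i).
by have := coord_le_norm (consV (a, y)) (lift ord0 j); rewrite mxE liftK.
Qed.

Lemma consV_line1 (y : 'rV[R]_n) (a h : R) :
  consV (h *: (1 : R) + a, y) = h *: delta_mx ord0 ord0 + consV (a, y).
Proof.
apply/rowP => i; rewrite !mxE; case: unliftP => [j ->|->] /=.
  by rewrite mulr0 add0r.
by [].
Qed.

Lemma consV_line2 (a : R) (j : 'I_n) (y : 'rV[R]_n) (h : R) :
  consV (a, h *: delta_mx ord0 j + y) =
  h *: delta_mx ord0 (lift ord0 j) + consV (a, y).
Proof.
apply/rowP => i; rewrite !mxE; case: unliftP => [k ->|->] /=.
  by rewrite !mxE (inj_eq lift_inj).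
by rewrite ?(negbTE (neq_lift _ _)) ?andbF mulr0 add0r.
Qed.

Lemma continuous_consV1 (y : 'rV[R]_n) : continuous (fun a : R => consV (a, y)).
Proof.
have -> : (fun a : R => consV (a, y)) =
          (fun a : R => a *: delta_mx ord0 ord0 + consV (0, y)).
  by apply/funext => a; rewrite -consV_line1 [_ *: 1]mulr1 addr0.
by move=> a; apply: cvgD; [exact: scalel_continuous|exact: cvg_cst].
Qed.

Lemma continuous_consV2 (a : R) : continuous (fun y : 'rV[R]_n => consV (a, y)).
Proof.
move=> y; apply/(@cvgrPdist_lt _ _ _ (nbhs y) (nbhs_filter y)) => e e0; near=> z.
have -> : consV (a, y) - consV (a, z) = consV (0, y - z).
  by apply/rowP => i; rewrite !mxE; case: unliftP => [j _|_] /=; rewrite ?mxE ?subrr.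
apply: (@le_lt_trans _ _ `|y - z|).
  rewrite [leLHS]/Num.norm /= mx_normrE.
  apply/bigmax_leP; split => //= -[i j] _ /=; rewrite mxE.
  case: unliftP => [k _|_] /=; last by rewrite normr0.
  exact: (coord_le_norm (y - z)).
near: z; by have := @nbhsx_ballx _ 'rV[R]_n y e e0; rewrite -ball_normE.
Unshelve. all: end_near. Qed.

End consV_slices.

(** Integration by parts without regularity of the boundary: the coordinate
    [i] is either the first one, and the slices are sets of reals, or one of the
    others, and the slices fall under the induction hypothesis. *)
Lemma integral_vanishing_primitive (R : realType) n (i : 'I_n)
    (Omega : set 'rV[R]_n) (W g : 'rV[R]_n -> R) :
  vanishing_primitive Omega (delta_mx ord0 i) W g ->
  (\int[lebesgue_rV n]_(x in Omega) (g x)%:E = 0)%E.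
Proof.
elim: n i Omega W g => [[]//|n IHn] i Omega W g VP.
have [oO bO cW cg _] := VP.
have mO := open_measurable_rV oO.
have intg := integrable_rV_closure oO bO cg.
have intf := (integrable_mkcond _ mO).1 intg.
rewrite integral_mkcond.
set f := (_ \_ _) in intf *.
have mf : measurable_fun setT f by exact: measurable_int intf.
have mc := @measurable_consV R n.
have intfc : ((lebesgue_measure \x lebesgue_rV n)%E).-integrable setT (f \o @consV R n).
  apply/integrableP; split; first exact: measurableT_comp.
  have /integrableP[_] := intf.
  rewrite [X in (X < _)%E -> _](_ : _ = \int[pushforward
    (lebesgue_measure \x lebesgue_rV n)%E (@consV R n)]_x `|f x|)%E//.
  rewrite ge0_integral_pushforward//.
  exact: measurableT_comp.
transitivity (\int[(lebesgue_measure \x lebesgue_rV n)%E]_z (f \o @consV R n) z)%E.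
  transitivity (\int[pushforward
    (lebesgue_measure \x lebesgue_rV n)%E (@consV R n)]_x f x)%E => //.
  by rewrite integral_pushforward.
case: (unliftP ord0 i) VP => [j ->|->] VP.
- rewrite -integral12_prod_meas1//.
  rewrite integral0_eq// => a _.
  rewrite /fubini_F -(IHn j _ _ _ (vanishing_primitive_slice
    (@continuous_consV2 _ _ a) (@le_norm_consV2 _ _ a) (@consV_line2 _ _ a j) VP)).
  by rewrite [RHS]integral_mkcond.
- rewrite -integral21_prod_meas1//.
  rewrite integral0_eq// => y _.
  rewrite /fubini_G -(integral_vanishing_primitive1 (vanishing_primitive_slice
    (@continuous_consV1 _ _ y) (@le_norm_consV1 _ _ y) (@consV_line1 _ _ y) VP)).
  by rewrite [RHS]integral_mkcond.
Qed.

(** * A family of cutoff functions *)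

Section cutoff.
Context {R : realType}.
Implicit Types (d q s : R).

(** The positive part, in a form that is visibly continuous. *)
Definition pos_part q : R := (q + `|q|) / 2.

(** With [p] the positive part of [q], the function [p^2 / (p + d)] is of class
    C^1, vanishes for [q <= 0], and tends to [p] as [d] tends to 0; [dsoft] is
    its derivative. *)
Definition soft d q : R := pos_part q ^+ 2 / (pos_part q + d).

Definition dsoft d q : R := 1 - (d / (pos_part q + d)) ^+ 2.

(** An odd C^1 function that vanishes on [[-d, d]] and is close to the identity
    elsewhere; [dcutoff] is its derivative. *)
Definition cutoff d s : R := soft d (s - d) - soft d (- s - d).

Definition dcutoff d s : R := dsoft d (s - d) + dsoft d (- s - d).

Lemma pos_part_ge0 q : 0 <= pos_part q.
Proof. by rewrite /pos_part divr_ge0// -lerBlDl sub0r -normrN ler_norm. Qed.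

Lemma pos_part_pos q : 0 <= q -> pos_part q = q.
Proof. by move=> q0; rewrite /pos_part ger0_norm//; field. Qed.

Lemma pos_part_neg q : q <= 0 -> pos_part q = 0.
Proof. by move=> q0; rewrite /pos_part ler0_norm// subrr mul0r. Qed.

Lemma continuous_pos_part : continuous pos_part.
Proof.
move=> q; apply: cvgM; last exact: cvg_cst.
by apply: cvgD; [exact: cvg_id|exact: norm_continuous].
Qed.

Lemma is_derive_soft d q : 0 < d -> is_derive q 1 (soft d) (dsoft d q).
Proof.
move=> d0; have [q0|q0|->] := ltgtP q 0.
- rewrite /dsoft pos_part_neg ?(ltW q0)// add0r divff ?gt_eqF// expr1n subrr.
  apply: (@near_eq_is_derive _ _ _ (cst 0)).
  near=> y; rewrite /soft pos_part_neg ?expr0n/= ?mul0r//.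
  by apply: ltW; near: y; exact: lt_nbhsl.
- rewrite /dsoft pos_part_pos ?(ltW q0)//.
  apply: (@near_eq_is_derive _ _ _ (fun y => y - d + d ^+ 2 * (y + d)^-1)).
    near=> y; have y0 : 0 < y by near: y; exact: lt_nbhsr.
    rewrite /soft pos_part_pos ?(ltW y0)//; field.
    by rewrite gt_eqF// addr_gt0.
  have qd : q + d != 0 by rewrite gt_eqF// addr_gt0.
  have h : is_derive q 1 (fun y : R => (y + d)^-1) (- (q + d) ^- 2 *: (1 + 0 : R)).
    exact: (@is_deriveV _ (fun y => y + d)).
  by apply: is_derive_eq; rewrite /GRing.scale/=; field.
(* At the junction the difference quotient is at most [|h| / d]. *)
- have -> : dsoft d 0 = 0.
    by rewrite /dsoft pos_part_pos// add0r divff ?gt_eqF// expr1n subrr.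
  have s0 : soft d 0 = 0 by rewrite /soft pos_part_pos// expr0n/= mul0r.
  have c0 : h^-1 *: (soft d (h *: (1:R) + 0) - soft d 0) @[h --> (0:R)^'] --> (0:R).
    apply: (@cvg_to_0_linear _ _ d^-1 1) => // h /andP[h0 _].
    rewrite s0 subr0 addr0 [_ *: 1]mulr1 /GRing.scale/= normrM normfV.
    rewrite ler_pdivrMl// /soft.
    have [hp|hn] := leP 0 h; last first.
      rewrite pos_part_neg ?(ltW hn)// expr0n/= mul0r normr0.
      by rewrite !mulr_ge0// invr_ge0 ltW.
    rewrite pos_part_pos// !ger0_norm//; last first.
      by rewrite divr_ge0 ?exprn_ge0 ?addr_ge0 ?(ltW d0).
    rewrite mulrCA -expr2 mulrC ler_wpM2r ?exprn_ge0//.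
    by rewrite lef_pV2 ?posrE// ?lerDr// ltr_pwDr.
  apply: DeriveDef; first by apply/cvg_ex; exists 0.
  exact: cvg_lim c0.
Unshelve. all: end_near. Qed.

Lemma continuous_dsoft d : 0 < d -> continuous (dsoft d).
Proof.
move=> d0 q; apply: cvgB; first exact: cvg_cst.
apply: cvgM; (apply: cvgM; first exact: cvg_cst);
  apply: cvgV; rewrite ?gt_eqF ?ltr_wpDl ?pos_part_ge0//;
  by apply: cvgD; [exact: continuous_pos_part|exact: cvg_cst].
Qed.

Lemma is_derive_cutoff d s : 0 < d -> is_derive s 1 (cutoff d) (dcutoff d s).
Proof.
move=> d0.
have h1 : is_derive s 1 (soft d \o (fun y => y - d)) (dsoft d (s - d) * (1 - 0)).
  by apply: is_derive1_comp; exact: is_derive_soft.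
have h2 : is_derive s 1 (soft d \o (fun y => - y - d)) (dsoft d (- s - d) * (- 1 - 0)).
  by apply: is_derive1_comp; exact: is_derive_soft.
have -> : dcutoff d s = dsoft d (s - d) * (1 - 0) - dsoft d (- s - d) * (- 1 - 0).
  by rewrite /dcutoff; ring.
exact: is_deriveB.
Qed.

Lemma continuous_cutoff d : 0 < d -> continuous (cutoff d).
Proof.
move=> d0 s; apply/differentiable_continuous; rewrite -derivable1_diffP.
by have [] := is_derive_cutoff s d0.
Qed.

Lemma continuous_dcutoff d : 0 < d -> continuous (dcutoff d).
Proof.
move=> d0 s; apply: cvgD.
  apply: (continuous_comp (f := fun y => y - d) (g := dsoft d)).
    by apply: cvgB; [exact: cvg_id|exact: cvg_cst].
  exact: continuous_dsoft.
apply: (continuous_comp (f := fun y => - y - d) (g := dsoft d)).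
  by apply: cvgB; [apply: cvgN; exact: cvg_id|exact: cvg_cst].
exact: continuous_dsoft.
Qed.

Lemma cutoff_small d s : `|s| <= d -> cutoff d s = 0.
Proof.
rewrite ler_norml => /andP[s1 s2];
rewrite /cutoff /soft !pos_part_neg ?expr0n/= ?mul0r ?subrr//; lra.
Qed.

Lemma dcutoff_small d s : 0 < d -> `|s| <= d -> dcutoff d s = 0.
Proof.
move=> d0; rewrite ler_norml => /andP[s1 s2].
rewrite /dcutoff /dsoft !pos_part_neg ?add0r ?divff ?gt_eqF ?expr1n ?subrr ?addr0//; lra.
Qed.

Lemma cutoffN d s : cutoff d (- s) = - cutoff d s.
Proof. by rewrite /cutoff opprK opprB. Qed.

Lemma dcutoffN d s : dcutoff d (- s) = dcutoff d s.
Proof. by rewrite /dcutoff opprK addrC. Qed.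

Lemma cutoff_large d s : 0 < d -> d <= s -> cutoff d s = s - d *+ 2 + d ^+ 2 / s.
Proof.
move=> d0 ds; have s0 : 0 < s := lt_le_trans d0 ds.
rewrite /cutoff /soft pos_part_pos ?subr_ge0// pos_part_neg; last by lra.
by rewrite expr0n/= mul0r subr0 subrK; field; rewrite gt_eqF.
Qed.

Lemma dcutoff_large d s : 0 < d -> d <= s -> dcutoff d s = 1 - (d / s) ^+ 2.
Proof.
move=> d0 ds; have s0 : 0 < s := lt_le_trans d0 ds.
rewrite /dcutoff /dsoft pos_part_pos ?subr_ge0// pos_part_neg; last by lra.
by rewrite add0r divff ?gt_eqF// subrK; ring.
Qed.

Lemma cutoff_near_id d s : 0 < d -> `|cutoff d s - s| <= d *+ 2.
Proof.
move=> d0; wlog s0 : s / 0 <= s.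
  move=> H; have [/H//|/ltW s0] := leP 0 s.
  have := H (- s); rewrite oppr_ge0 cutoffN opprK addrC distrC; exact.
have [ds|sd] := leP d s.
  have sp := lt_le_trans d0 ds.
  rewrite cutoff_large// ler_norml mulr2n.
  have : 0 <= d ^+ 2 / s <= d.
    by rewrite divr_ge0 ?exprn_ge0 ?(ltW d0)//= ler_pdivrMr// expr2 ler_pM2l.
  by move: (d ^+ 2 / s) => z; lra.
rewrite cutoff_small; last by rewrite ger0_norm// ltW.
by rewrite sub0r normrN ger0_norm// mulr2n; lra.
Qed.

Lemma dcutoff_near1 d s : 0 < d -> s != 0 -> `|dcutoff d s - 1| <= d / `|s|.
Proof.
move=> d0; wlog s0 : s / 0 <= s.
  move=> H; have [/H//|/ltW s0 sn0] := leP 0 s.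
  by rewrite -dcutoffN -(normrN s) H ?oppr_ge0 ?oppr_eq0.
move=> sn0; have sp : 0 < s by rewrite lt_def sn0.
rewrite (ger0_norm s0); have [ds|sd] := leP d s.
  rewrite dcutoff_large// addrAC subrr sub0r normrN.
  have ds0 : 0 <= d / s by rewrite divr_ge0 ?(ltW d0).
  rewrite ger0_norm ?exprn_ge0// expr2 ler_piMl//.
  by rewrite ler_pdivrMr// mul1r.
rewrite dcutoff_small//; last by rewrite ger0_norm// ltW.
rewrite sub0r normrN normr1.
by rewrite ler_pdivlMr// mul1r ltW.
Qed.

Lemma dcutoff_bounded d s : 0 < d -> 0 <= dcutoff d s <= 2.
Proof.
move=> d0.
have h q : 0 <= (d / (pos_part q + d)) ^+ 2 <= 1.
  have p0 := pos_part_ge0 q; have pd : 0 < pos_part q + d by rewrite ltr_wpDl.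
  rewrite exprn_ge0 ?divr_ge0 ?(ltW d0) ?(ltW pd)//= exprn_ile1//.
    by rewrite divr_ge0 ?(ltW d0) ?(ltW pd).
  by rewrite ler_pdivrMr// mul1r lerDr.
rewrite /dcutoff /dsoft; have := h (s - d); have := h (- s - d); lra.
Qed.

End cutoff.

(** * The Poincare inequality up to the boundary *)

Section within_continuous.
Context {R : realType} {T : topologicalType}.
Variable A : set T.
Implicit Types f g : T -> R.

Lemma within_continuousD f g : {within A, continuous f} ->
  {within A, continuous g} -> {within A, continuous (fun x => f x + g x)}.
Proof. by move=> cf cg x; apply: cvgD; [exact: cf|exact: cg]. Qed.

Lemma within_continuousB f g : {within A, continuous f} ->
  {within A, continuous g} -> {within A, continuous (fun x => f x - g x)}.
Proof. by move=> cf cg x; apply: cvgB; [exact: cf|exact: cg]. Qed.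

Lemma within_continuousM f g : {within A, continuous f} ->
  {within A, continuous g} -> {within A, continuous (fun x => f x * g x)}.
Proof. by move=> cf cg x; apply: cvgM; [exact: cf|exact: cg]. Qed.

Lemma within_continuousZ (k : R) f : {within A, continuous f} ->
  {within A, continuous (fun x => k * f x)}.
Proof. by move=> cf x; apply: cvgM; [exact: cvg_cst|exact: cf]. Qed.

Lemma within_continuousX f n : {within A, continuous f} ->
  {within A, continuous (fun x => f x ^+ n)}.
Proof.
move=> cf; elim: n => [|n IH].
  by under eq_fun do rewrite expr0; move=> x; exact: cvg_cst.
by under eq_fun do rewrite exprS; exact: within_continuousM.
Qed.

Lemma within_continuous_sum n (f : 'I_n -> T -> R) :
  (forall i, {within A, continuous (f i)}) ->
  {within A, continuous (fun x => \sum_(i < n) f i x)}.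
Proof.
elim: n f => [|n IH] f cf.
  by under eq_fun do rewrite big_ord0; move=> x; exact: cvg_cst.
under eq_fun do rewrite big_ord_recr.
by apply: within_continuousD => //; exact: IH.
Qed.

Lemma closed_within_ge f d : closed A -> {within A, continuous f} ->
  closed [set x | A x /\ d <= `|f x|].
Proof.
move=> cA cf.
have cB : closed [set s : R | d <= `|s|].
  rewrite (_ : mkset _ = (fun s : R => `|s|) @^-1` [set s | d <= s]).
    apply: preimage_closed; last exact: closed_ge.
    by move=> x _; exact: norm_continuous.
  by [].
have /closed_subspaceP[V cV VA] := (continuous_closedP _).1 cf _ cB.
rewrite (_ : [set x | _] = V `&` A); first exact: closedI.
by rewrite VA; apply/seteqP; split => x [].
Qed.

End within_continuous.

Lemma is_derive_lineP (R : realType) (V : normedModType R) (x v : V)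
    (f : V -> R) (l : R) :
  is_derive x v f l <-> is_derive (0 : R) 1 (fun t : R => f (t *: v + x)) l.
Proof.
split=> [fl|].
  apply: (@is_derive_affine _ _ _ (fun t : R => t *: v + x) 1 v).
    by move=> h; rewrite [_ *: 1]mulr1 addr0 scale0r add0r.
  by rewrite scale0r add0r.
have E : (fun h : R => h^-1 *: (f (h *: v + x) - f x)) =
    (fun h : R => h^-1 *: (f ((h *: (1 : R) + 0) *: v + x) - f (0 *: v + x))).
  by apply/funext => h; rewrite scale0r add0r addr0 [_ *: 1]mulr1.
case=> df <-; apply: DeriveDef; first by rewrite /derivable E.
by rewrite /derive E.
Qed.

Lemma is_derive_compose (R : realType) (V : normedModType R) (x v : V)
    (eta : R -> R) (f : V -> R) (a l : R) :
  is_derive (f x) 1 eta a -> is_derive x v f l ->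
  is_derive x v (eta \o f) (a * l).
Proof.
move=> ea /is_derive_lineP fl; apply/is_derive_lineP.
apply: (@is_derive1_comp _ eta (fun t : R => f (t *: v + x))) => //.
by rewrite scale0r add0r.
Qed.

(** A function on [Omega] that vanishes outside a closed set [K] contained in
    [Omega] keeps its regularity when extended by 0, because [Omega] and the
    complement of [K] cover the space. *)
Section extension_by_zero.
Context {R : realType} {V : normedModType R}.
Variables (Omega K : set V).
Hypotheses (oO : open Omega) (cK : closed K) (KO : K `<=` Omega).

Lemma near_extension_by_zero (h : V -> R) (x : V) :
  (forall y, Omega y -> ~ K y -> h y = 0) ->
  (Omega x /\ \near x, h x = (h \_ Omega) x) \/
  (~ Omega x /\ \near x, 0 = (h \_ Omega) x).
Proof.
move=> h0; have [Ox|nOx] := pselect (Omega x); [left|right]; split => //.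
  have := open_nbhs_nbhs (conj oO Ox); apply: filterS => y Oy.
  by rewrite patchT// inE.
have : nbhs x (~` K).
  by apply: open_nbhs_nbhs; split; [exact: closed_openC|move=> /KO].
apply: filterS => y nKy; rewrite /patch; case: ifPn => //.
by rewrite inE => Oy; rewrite h0.
Qed.

Lemma continuous_extension_by_zero (h : V -> R) :
  {within Omega, continuous h} -> (forall y, Omega y -> ~ K y -> h y = 0) ->
  continuous (h \_ Omega).
Proof.
move=> ch h0 x; have [[Ox nh]|[nOx nh]] := near_extension_by_zero x h0.
  rewrite continuous_open_subspace// in ch.
  rewrite /continuous_at [X in _ --> X]patchT ?inE//.
  by apply: cvg_trans (ch x (mem_set Ox)); exact: near_eq_cvg.
rewrite /continuous_at [X in _ --> X]patchE memNset//.
have c0 : (fun=> 0 : R) y @[y --> x] --> (0 : R) by exact: cvg_cst.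
by apply: cvg_trans c0; apply: near_eq_cvg.
Qed.

Lemma is_derive_extension_by_zero (h dh : V -> R) (x v : V) :
  (forall y, Omega y -> is_derive y v h (dh y)) ->
  (forall y, Omega y -> ~ K y -> h y = 0) ->
  is_derive x v (h \_ Omega) ((dh \_ Omega) x).
Proof.
move=> hd h0; have [[Ox nh]|[nOx nh]] := near_extension_by_zero x h0.
  rewrite [X in is_derive _ _ _ X]patchT ?inE//.
  by apply: near_eq_is_derive nh _; exact: hd.
rewrite [X in is_derive _ _ _ X]patchE memNset//.
by apply: near_eq_is_derive nh _.
Qed.

End extension_by_zero.

Lemma sqint_cvg0 (R : realType) n (Omega : set 'rV[R]_n)
    (f : nat -> 'rV[R]_n -> R) (M : R) :
  open Omega -> bounded_set Omega ->
  (forall k, measurable_fun Omega (f k)) ->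
  (forall k x, Omega x -> `|f k x| <= M) ->
  (forall x, Omega x -> f k x @[k --> \oo] --> (0:R)) ->
  sqint Omega (f k) @[k --> \oo] --> 0%E.
Proof.
move=> oO bO mf fM f0; have mO := open_measurable_rV oO.
rewrite -(@integral0 _ _ _ (lebesgue_rV n) Omega).
apply: (@dominated_cvg _ _ _ (lebesgue_rV n) Omega mO
  (fun k x => (f k x ^+ 2)%:E) (cst 0%E) (cst (M ^+ 2)%:E)).
- by move=> k; apply/measurable_EFinP; exact: measurable_funX.
- move=> x Ox; apply: cvg_EFin; first exact: nearW.
  by have := cvgM (f0 x Ox) (f0 x Ox); rewrite mulr0; exact.
- by [].
- apply: (integrable_rV_bounded (M := `|M ^+ 2|)) => //.
- move=> k x Ox; rewrite lee_fin normrX ler_sqr ?nnegrE//.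
    exact: fM.
  exact: le_trans (fM k x Ox).
Qed.

Lemma cvg0_harmonic (R : realType) (f : nat -> R) (c : R) :
  (forall k, `|f k| <= c * harmonic k) -> f k @[k --> \oo] --> (0 : R).
Proof.
move=> fc; apply: norm_cvg0.
apply: (@squeeze_cvgr _ _ _ _ (cst 0) (fun k => c * harmonic k)).
- by apply: nearW => k; rewrite normr_ge0/= fc.
- exact: cvg_cst.
- rewrite -[X in _ --> X](mulr0 c); apply: cvgM; first exact: cvg_cst.
  exact: cvg_harmonic.
Qed.

(** The Poincare inequality for a function [w] of class C^1 up to the boundary
    that vanishes on the boundary. The functions [cutoff d (w x)] are compactly
    supported in [Omega]; as [d] tends to 0 they converge to [w], and their
    gradients to the gradient of [w] cut to 0 on the zero set of [w]. With this
    function [g] as weak gradient, [w] is in [H10], and the norm of [g] is at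
    most that of the gradient of [w]; it is not necessary to know that the
    gradient of [w] vanishes almost everywhere on the zero set. *)
Section poincare_C1.
Context {R : realType}.
Variables (n : nat) (Omega : set 'rV[R]_n) (lambda : R).
Hypotheses (oO : open Omega) (bO : bounded_set Omega).
Variables (w : 'rV[R]_n -> R) (dw : 'rV[R]_n -> 'rV[R]_n -> R).
Hypothesis cw : {within closure Omega, continuous w}.
Hypothesis wd : forall v x, Omega x -> is_derive x v w (dw v x).
Hypothesis cdw : forall v, {within closure Omega, continuous (dw v)}.
Hypothesis w0 : forall x, closure Omega x -> ~ Omega x -> w x = 0.

Let sO : Omega `<=` closure Omega := @subset_closure _ Omega.
Let mO : measurable Omega := open_measurable_rV oO.

Let K d := [set x | closure Omega x /\ d <= `|w x|].

Let KO d : 0 < d -> K d `<=` Omega.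
Proof.
move=> d0 x [clx dx]; apply: contrapT => nOx.
by move: dx; rewrite w0// normr0 leNgt d0.
Qed.

Let cK d : closed (K d).
Proof. by apply: closed_within_ge => //; exact: closed_closure. Qed.

Let phi d := (cutoff d \o w) \_ Omega.

Let phi0 d y : Omega y -> ~ K d y -> (cutoff d \o w) y = 0.
Proof.
move=> Oy nK; apply: cutoff_small; rewrite leNgt; apply/negP => /ltW dw'.
by apply: nK; split => //; exact: sO.
Qed.

Let dphi0 d v y : 0 < d -> Omega y -> ~ K d y -> dcutoff d (w y) * dw v y = 0.
Proof.
move=> d0 Oy nK; rewrite dcutoff_small ?mul0r// leNgt; apply/negP => /ltW dw'.
by apply: nK; split => //; exact: sO.
Qed.

Let cwO : {within Omega, continuous w} := continuous_subspaceW sO cw.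
Let cdwO v : {within Omega, continuous (dw v)} := continuous_subspaceW sO (@cdw v).

Let phiD d v x : 0 < d ->
  is_derive x v (phi d) (((fun y => dcutoff d (w y) * dw v y) \_ Omega) x).
Proof.
move=> d0; apply: (@is_derive_extension_by_zero _ _ _ _ oO (@cK d) (@KO d d0)
  (cutoff d \o w) (fun y => dcutoff d (w y) * dw v y)).
  move=> y Oy; apply: is_derive_compose; last exact: wd.
  exact: is_derive_cutoff.
exact: phi0.
Qed.

Let phi_C1c d : 0 < d -> C1c Omega (phi d).
Proof.
move=> d0; split.
- split.
    apply: continuous_subspaceT.
    apply: (@continuous_extension_by_zero _ _ _ _ oO (@cK d) (@KO d d0)); last exact: phi0.
    by move=> x; apply: (continuous_comp (cwO (x := x))); exact: continuous_cutoff.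
  move=> v; exists ((fun y => dcutoff d (w y) * dw v y) \_ Omega).
    by move=> z _; exact: phiD.
  split => //; apply: continuous_subspaceT.
  apply: (@continuous_extension_by_zero _ _ _ _ oO (@cK d) (@KO d d0)); last first.
    by move=> y; exact: dphi0.
  apply: within_continuousM => //.
  by move=> x; apply: (continuous_comp (cwO (x := x))); exact: continuous_dcutoff.
- apply: (@subclosed_compact _ _ (closure Omega)); [exact: closed_closure| |].
    exact: compact_closure_rV.
  apply: closureS => x /=; rewrite /phi patchE; case: ifPn; last by rewrite eqxx.
  by rewrite inE.
- apply: (subset_trans _ (KO d0)).
  rewrite [X in _ `<=` X]((closure_id _).1 (@cK d)).
  apply: closureS => x /=; rewrite /phi patchE; case: ifPn; last by rewrite eqxx.
  rewrite inE => Ox /eqP h; apply: contrapT => nK; apply: h; exact: phi0.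
Qed.

Let g i x := if w x == 0 then 0 else dw (delta_mx ord0 i) x.

Let mw : measurable_fun Omega w := measurable_fun_within_rV mO cwO.
Let mdw v : measurable_fun Omega (dw v) := measurable_fun_within_rV mO (@cdwO v).

Let mg i : measurable_fun Omega (g i).
Proof.
apply: measurable_fun_if => //.
- exact: measurable_fun_eqr.
- by apply: measurable_funS (@mdw _) => // x [].
Qed.

Let harm_gt0 k : 0 < (harmonic k : R). Proof. exact: harmonic_gt0. Qed.

Let harm_le1 k : (harmonic k : R) <= 1.
Proof. by rewrite /harmonic invf_le1// ler1n. Qed.

Let partial_phi d i x : 0 < d -> Omega x ->
  partial i (phi d) x = dcutoff d (w x) * dw (delta_mx ord0 i) x.
Proof.
move=> d0 Ox; rewrite /partial.
by have [_ ->] := @phiD d (delta_mx ord0 i) x d0; rewrite patchT// inE.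
Qed.

Let sqint_fin (f : 'rV[R]_n -> R) (M : R) : measurable_fun Omega f ->
  (forall x, Omega x -> `|f x| <= M) -> (sqint Omega f < +oo)%E.
Proof.
move=> mf fM.
have : (lebesgue_rV n).-integrable Omega (EFin \o (fun x => f x ^+ 2)).
  apply: (integrable_rV_bounded (M := M ^+ 2)) => //; first exact: measurable_funX.
  move=> x Ox; rewrite normrX ler_sqr ?nnegrE//; first exact: fM.
  exact: le_trans (fM _ Ox).
by move=> /(integrable_fin_num mO); rewrite fin_numElt => /andP[].
Qed.

Let w_H10 : H10 Omega w g.
Proof.
have cc := compact_closure_rV bO.
have [M _ wM] := within_continuous_compact_bounded cc cw.
have [D D0 dwD] : exists2 D, 0 <= D & forall i x, Omega x -> `|dw (delta_mx ord0 i) x| <= D.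
  have /choice[B hB] : forall i : 'I_n, exists B, 0 <= B /\
      forall x, Omega x -> `|dw (delta_mx ord0 i) x| <= B.
    move=> i; have [B B0 hB] := within_continuous_compact_bounded cc (@cdw (delta_mx ord0 i)).
    by exists B; split => // x Ox; apply: hB; exact: sO.
  exists (\sum_i B i); first by apply: sumr_ge0 => i _; exact: (hB i).1.
  move=> i x Ox; apply: (le_trans ((hB i).2 _ Ox)).
  by rewrite (bigD1 i)//= lerDl; apply: sumr_ge0 => j _; exact: (hB j).1.
split.
- by split => //; apply: (@sqint_fin _ M) => // x Ox; apply: wM; exact: sO.
- move=> i; split => //; apply: (@sqint_fin _ D) => // x Ox.
  by rewrite /g; case: ifP => _; rewrite ?normr0// dwD.
exists (fun k => phi (harmonic k)); split => [k| |i]; first exact: phi_C1c.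
- apply: (@sqint_cvg0 _ _ _ _ 2) => //.
  + move=> k; apply: measurable_funB => //; apply: measurable_fun_within_rV => //.
    have [[+ _] _ _] := phi_C1c (harm_gt0 k).
    by apply: continuous_subspaceW => x _; apply: subset_closure.
  + move=> k x Ox; rewrite /phi patchT ?inE//=.
    apply: (le_trans (cutoff_near_id _ (harm_gt0 k))).
    by have := harm_le1 k; rewrite mulr2n; lra.
  + move=> x Ox; apply: (@cvg0_harmonic _ _ 2) => k.
    rewrite /phi patchT ?inE//= (le_trans (cutoff_near_id _ (harm_gt0 k)))//.
    by rewrite mulr_natl.
- rewrite (_ : (fun k => _) = (fun k => sqint Omega (fun x =>
    dcutoff (harmonic k) (w x) * dw (delta_mx ord0 i) x - g i x))); last first.
    apply/funext => k; apply: eq_integral => x; rewrite inE => Ox.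
    by rewrite partial_phi.
  have gE x : g i x = (w x != 0)%:R * dw (delta_mx ord0 i) x.
    by rewrite /g; case: eqP => _; rewrite ?mul0r ?mul1r.
  have bnd k x : Omega x -> `|dcutoff (harmonic k) (w x) * dw (delta_mx ord0 i) x - g i x|
      <= 1 * `|dcutoff (harmonic k) (w x) - (w x != 0)%:R| * D.
    by move=> Ox; rewrite gE -mulrBl normrM mul1r ler_wpM2l// dwD.
  apply: (@sqint_cvg0 _ _ _ _ (2 * D)) => //.
  + move=> k; apply: measurable_funB => //; apply: measurable_funM => //.
    have mc : measurable_fun setT (dcutoff (harmonic k) : R -> R).
      exact: continuous_measurable_fun (continuous_dcutoff (harm_gt0 k)).
    exact: (measurableT_comp mc mw).
  + move=> k x Ox; apply: (le_trans (bnd _ _ Ox)); rewrite mul1r ler_wpM2r//.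
    have h := dcutoff_bounded (w x) (harm_gt0 k).
    by rewrite ler_norml; case: (w x != 0) => /=; rewrite ?mulr1n ?mulr0n; lra.
  + move=> x Ox; have [wx0|wx0] := eqVneq (w x) 0.
      apply: (@cvg0_harmonic _ _ 0) => k.
      rewrite gE wx0 eqxx dcutoff_small//; last by rewrite normr0 ltW.
      by rewrite /= !mul0r subr0 normr0.
    apply: (@cvg0_harmonic _ _ (D / `|w x|)) => k.
    apply: (le_trans (bnd _ _ Ox)); rewrite wx0 mul1r mulrC -mulrA ler_wpM2l//.
    by rewrite mulrC dcutoff_near1.
Qed.

Lemma poincare_C1 : poincare Omega lambda ->
  lambda * \int[lebesgue_rV n]_(x in Omega) (w x ^+ 2) <=
  \int[lebesgue_rV n]_(x in Omega) (\sum_(i < n) dw (delta_mx ord0 i) x ^+ 2).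
Proof.
have iw : (lebesgue_rV n).-integrable Omega (EFin \o (fun x => w x ^+ 2)).
  by apply: integrable_rV_closure => //; exact: within_continuousX.
have idw : (lebesgue_rV n).-integrable Omega
    (EFin \o (fun x => \sum_(i < n) dw (delta_mx ord0 i) x ^+ 2)).
  apply: integrable_rV_closure => //; apply: within_continuous_sum => i.
  exact: within_continuousX.
move=> /(_ _ _ w_H10); rewrite /sqint.
rewrite -(fineK (integrable_fin_num mO iw)) -EFinM => h.
rewrite -lee_fin; apply: (le_trans h).
rewrite [leRHS](fineK (integrable_fin_num mO idw)).
apply: ge0_le_integral => //.
- by move=> x Ox; rewrite lee_fin; apply: sumr_ge0 => i _; exact: sqr_ge0.
- apply/measurable_EFinP; apply: measurable_sum => i; exact: measurable_funX.
- exact: (measurable_int _ idw).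
- move=> x Ox; rewrite lee_fin; apply: ler_sum => i _; rewrite /g.
  by case: ifP => // _; rewrite expr0n/= sqr_ge0.
Qed.

End poincare_C1.

(** * Directional derivatives along segments *)

Section segment.
Context {R : realType} {V : normedModType R}.
Implicit Types (f g : V -> R) (z v a b : V).

Lemma MVT_line f g z v (h : R) : 0 < h ->
  (forall s, 0 <= s <= h -> is_derive (s *: v + z) v f (g (s *: v + z))) ->
  exists2 c, 0 < c < h & f (h *: v + z) - f z = h * g (c *: v + z).
Proof.
move=> h0 df.
have dphi s : 0 <= s <= h ->
    is_derive s 1 (fun s : R => f (s *: v + z)) (g (s *: v + z)).
  move=> sh; apply: (@is_derive_affine _ _ _ (fun s : R => s *: v + z) 1 v).
    by move=> k; rewrite [_ *: 1]mulr1 scalerDl addrA.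
  exact: df.
have [s sh|s|c] := @MVT R (fun s : R => f (s *: v + z)) (fun s => g (s *: v + z)) 0 h h0.
- by apply: dphi; move: sh; rewrite in_itv/= => /andP[s0 sh]; rewrite !ltW.
- apply: derivable_within_continuous => {}s sh.
  by move: sh; rewrite in_itv/= => /dphi[].
- rewrite in_itv/= => ch; rewrite scale0r add0r subr0 mulrC => E.
  by exists c.
Qed.

(** Two applications of the mean value theorem to the second difference of
    [f]. *)
Lemma second_difference f fa fab (A : set V) z a b (h : R) : 0 < h ->
  (forall s r, 0 <= s <= h -> 0 <= r <= h -> A (s *: a + (r *: b + z))) ->
  (forall y, A y -> is_derive y a f (fa y)) ->
  (forall y, A y -> is_derive y b fa (fab y)) ->
  exists s r, [/\ 0 < s < h, 0 < r < h &
    f (h *: a + (h *: b + z)) - f (h *: a + z) - (f (h *: b + z) - f z) =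
    h * (h * fab (s *: a + (r *: b + z)))].
Proof.
move=> h0 Ah df dfa.
have hh : 0 <= h <= h by rewrite (ltW h0) /=.
have h00 : 0 <= (0 : R) <= h by rewrite lexx ltW.
pose D y := f (y + h *: b) - f y.
have [s sh|s sh sE] := @MVT_line D (fun y => fa (y + h *: b) - fa y) z a h h0.
  have := Ah _ _ sh h00; rewrite scale0r add0r => A1.
  have := Ah _ _ sh hh; rewrite addrCA addrC => A2.
  apply: is_deriveB; last exact: df.
  apply: (@is_derive_affine _ _ _ (fun y => y + h *: b) a a).
    by move=> k; rewrite -!addrA.
  exact: df.
have sh' : 0 <= s <= h by case/andP: sh => s0 s1; rewrite !ltW.
have [r rh|r rh rE] := @MVT_line fa fab (s *: a + z) b h h0.
  apply: dfa; rewrite addrCA; exact: Ah.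
exists s, r; split => //.
have -> : f (h *: a + (h *: b + z)) - f (h *: a + z) - (f (h *: b + z) - f z) =
    D (h *: a + z) - D z.
  by rewrite /D (addrAC (h *: a) z) -(addrA (h *: a)) (addrC z (h *: b)).
by rewrite sE [s *: a + z + _]addrC rE [in RHS]addrCA.
Qed.

(** Symmetry of second directional derivatives. *)
Lemma schwarz f fa fb fab fba (A : set V) z a b : open A -> A z ->
  (forall y, A y -> is_derive y a f (fa y)) ->
  (forall y, A y -> is_derive y b f (fb y)) ->
  (forall y, A y -> is_derive y b fa (fab y)) ->
  (forall y, A y -> is_derive y a fb (fba y)) ->
  {for z, continuous fab} -> {for z, continuous fba} ->
  fab z = fba z.
Proof.
move=> oA Az dfa dfb dfab dfba cab cba.
apply/eqP; rewrite -subr_eq0 -normr_eq0; apply/eqP.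
apply/le_anti; rewrite normr_ge0 andbT; apply/ler_addgt0Pl => e e0; rewrite addr0.
have e2 : 0 < e / 2 by rewrite divr_gt0.
have /cvgrPdist_lt/(_ _ e2) nab := cab.
have /cvgrPdist_lt/(_ _ e2) nba := cba.
have /nbhs_ballP[d /= d0 hd] : \forall y \near z,
    [/\ A y, `|fab z - fab y| < e / 2 & `|fba z - fba y| < e / 2].
  near=> y; split.
  - by near: y; exact: open_nbhs_nbhs.
  - by near: y; exact: nab.
  - by near: y; exact: nba.
pose h := d / 2 / (`|a| + `|b| + 1).
have ab0 : 0 < `|a| + `|b| + 1 by rewrite ltr_wpDl// addr_ge0.
have h0 : 0 < h by rewrite !divr_gt0.
have hball s r : 0 <= s <= h -> 0 <= r <= h -> ball z d (s *: a + (r *: b + z)).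
  move=> /andP[s0 sh] /andP[r0 rh]; rewrite -ball_normE /=.
  rewrite (_ : z - _ = - (s *: a + r *: b)); last first.
    by rewrite addrA opprD addrCA subrr addr0.
  rewrite normrN (le_lt_trans (ler_normD _ _))// !normrZ !ger0_norm//.
  apply: (@le_lt_trans _ _ (h * (`|a| + `|b| + 1))).
    by rewrite 2!mulrDr mulr1 -[leLHS]addr0; rewrite !lerD ?(ltW h0)// ler_wpM2r.
  by rewrite /h mulrVK ?unitfE ?gt_eqF// ltr_pdivrMr// ltr_pMr// ltr1n.
have hA s r : 0 <= s <= h -> 0 <= r <= h -> A (s *: a + (r *: b + z)).
  by move=> sh rh; have [] := hd _ (hball _ _ sh rh).
have hA' s r : 0 <= s <= h -> 0 <= r <= h -> A (s *: b + (r *: a + z)).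
  by move=> sh rh; rewrite addrCA; exact: hA.
have [s [r [sh rh E1]]] := second_difference h0 hA dfa dfab.
have [s' [r' [sh' rh' E2]]] := second_difference h0 hA' dfb dfba.
have E : fab (s *: a + (r *: b + z)) = fba (s' *: b + (r' *: a + z)).
  have hn : h != 0 by rewrite gt_eqF.
  apply: (mulfI hn); apply: (mulfI hn); rewrite -E1 -E2 [h *: b + (h *: a + _)]addrCA.
  ring.
have cc (x : R) : 0 < x < h -> 0 <= x <= h by case/andP=> *; rewrite !ltW.
have [_ + _] := hd _ (hball _ _ (cc _ sh) (cc _ rh)).
have [_ _] := hd _ (hball _ _ (cc _ rh') (cc _ sh')).
rewrite addrCA -E => B1 B2.
rewrite -(subrK (fab (s *: a + (r *: b + z))) (fab z)) -addrA.
rewrite (le_trans (ler_normD _ _))// [leRHS](splitr e) lerD ?(ltW B2)//.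
by rewrite distrC ltW.
Unshelve. all: end_near. Qed.

(** The continuous extension [g] of a directional derivative to the closure is
    still the one-sided derivative of [f] at a point [z] of the closure, as soon
    as short segments in the direction [v] issued from points of [A] close to
    [z] stay in [A]. *)
Lemma right_derivative_closure f g (A : set V) z v (d : R) : 0 < d ->
  {within closure A, continuous f} -> {within closure A, continuous g} ->
  (forall y, A y -> is_derive y v f (g y)) ->
  closure A z ->
  (forall y s, A y -> ball z d y -> 0 <= s <= d -> A (s *: v + y)) ->
  h^-1 * (f (h *: v + z) - f z) @[h --> (0:R)^'+] --> g z.
Proof.
move=> d0 /subspace_continuousP cf /subspace_continuousP cg df clz seg.
have pF : ProperFilter (within A (nbhs z)) by exact: within_nbhs_proper.
have wAcl : within A (nbhs z) `=>` within (closure A) (nbhs z).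
  move=> P; rewrite /within/=; apply: filterS => y Py Ay.
  by apply: Py; exact: subset_closure.
apply/cvgrPdist_le => e e0.
have /cvgrPdist_lt/(_ e e0) := cg z clz.
rewrite /within /= => /nbhs_ballP[r /= r0 gr].
pose rho := Num.min d (r / 2).
have rho0 : 0 < rho by rewrite lt_min d0 divr_gt0.
near=> h.
have h0 : 0 < h by near: h; exact: nbhs_right_gt.
have hd : h <= d by apply: ltW; near: h; exact: nbhs_right_lt.
have hv : h * `|v| < r / 2.
  have : h < r / 2 / (`|v| + 1) by near: h; apply: nbhs_right_lt; rewrite !divr_gt0// ltr_wpDl.
  rewrite ltr_pdivlMr ?ltr_wpDl//; apply: le_lt_trans.
  by rewrite ler_wpM2l ?lerDl// ltW.
(* The estimate inside [A], by the mean value theorem; it passes to [z]. *)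
have main y : A y -> ball z rho y -> `|g z - h^-1 * (f (h *: v + y) - f y)| <= e.
  move=> Ay zy.
  have zyd : ball z d y by apply: le_ball zy; rewrite ge_min lexx.
  have [s sh|c ch ->] := @MVT_line f g y v h h0.
    apply: df; apply: seg => //.
    by case/andP: sh => -> /= /le_trans; exact.
  have cd : 0 <= c <= d.
    by case/andP: ch => c0 ch; rewrite ltW//= (le_trans (ltW ch)).
  rewrite mulrA mulVf ?gt_eqF// mul1r ltW//.
  apply: gr; last by apply: subset_closure; exact: seg.
  rewrite -ball_normE /= opprD addrCA.
  rewrite (le_lt_trans (ler_normD _ _))// normrN normrZ [ltRHS](splitr r).
  apply: ltr_leD.
    apply: le_lt_trans hv; rewrite ler_wpM2r//.
    by case/andP: ch => c0 ch; rewrite gtr0_norm// ltW.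
  have : ball z (r / 2) y by apply: le_ball zy; rewrite ge_min lexx orbT.
  by rewrite -ball_normE /= => /ltW.
have seg' : within A (nbhs z) [set y | A (h *: v + y)].
  apply: filterS (nbhsx_ballx z d d0) => y zy Ay; apply: seg => //.
  by rewrite (ltW h0).
have cshift : (h *: v + y) @[y --> within A (nbhs z)] --> h *: v + z.
  by apply: cvgD; [exact: cvg_cst|exact: cvg_within].
have clh : closure A (h *: v + z).
  move=> B /cshift nB.
  have [y [By Ay]] := filter_ex (filterI nB seg').
  by exists y.
have lim : `|g z - h^-1 * (f (h *: v + y) - f y)| @[y --> within A (nbhs z)] -->
    `|g z - h^-1 * (f (h *: v + z) - f z)|.
  apply: cvg_norm; apply: cvgB; first exact: cvg_cst.
  apply: cvgM; first exact: cvg_cst.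
  apply: cvgB; last by apply: cvg_trans (cf z clz) => P; exact: wAcl.
  apply: cvg_trans (cf _ clh) => P /= wP.
  apply: (@filterS _ (within A (nbhs z)) _ _ _ _ (filterI (cshift _ wP) seg')).
  by move=> y /= [+ Ay]; apply; exact: subset_closure.
apply: (@closed_cvg _ _ _ pF _ [set x | x <= e] _ _ _ lim).
  exact: closed_le.
by apply: filterS (nbhsx_ballx z rho rho0) => y zy Ay; exact: main.
Unshelve. all: end_near. Qed.

End segment.

(** * The decay rate *)

Section decay_rate.
Context {R : realType}.

Lemma quadratic_form_ge0 (a b m x y : R) : 0 <= a -> 0 <= b -> m ^+ 2 <= 4 * (a * b) ->
  0 <= a * x ^+ 2 + m * x * y + b * y ^+ 2.
Proof.
move=> a0 b0 mab; have [a00|an0] := eqVneq a 0.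
  move: mab; rewrite a00 mul0r mulr0 => m0.
  have -> : m = 0 by apply/eqP; rewrite -sqrf_eq0 eq_le m0 sqr_ge0.
  by rewrite !mul0r !add0r mulr_ge0// sqr_ge0.
have ap : 0 < a by rewrite lt_def an0.
rewrite -(pmulr_rge0 _ (_ : 0 < 4 * a)) ?mulr_gt0//.
have -> : 4 * a * (a * x ^+ 2 + m * x * y + b * y ^+ 2) =
    (2 * a * x + m * y) ^+ 2 + (4 * (a * b) - m ^+ 2) * y ^+ 2 by ring.
by rewrite addr_ge0 ?sqr_ge0// mulr_ge0 ?sqr_ge0// subr_ge0.
Qed.

(* The gap between the eigenvalues of the symmetric matrix with diagonal entries
   [eps] and [s0 - eps] and off-diagonal entry [eps (s1 - eps) / (2 sqrt lam)]. *)
Let disc (eps s0 s1 lam : R) : R := Num.sqrt ((s0 - 2 * eps) ^+ 2 * lam ^+ 2 +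
  eps ^+ 2 * (s1 - eps) ^+ 2 * lam) / lam.

Let decayFE (eps s0 s1 lam : R) : 0 < lam ->
  decayF eps s0 s1 lam = (s0 - disc eps s0 s1 lam) / 2.
Proof. by move=> l0; rewrite /decayF /disc; field; rewrite gt_eqF. Qed.

Let disc_ge0 (eps s0 s1 lam : R) : 0 < lam -> 0 <= disc eps s0 s1 lam.
Proof. by move=> l0; rewrite divr_ge0 ?sqrtr_ge0// ltW. Qed.

Let sqr_disc (eps s0 s1 lam : R) : 0 < lam -> disc eps s0 s1 lam ^+ 2 =
  (s0 - 2 * eps) ^+ 2 + eps ^+ 2 * (s1 - eps) ^+ 2 / lam.
Proof.
move=> l0; rewrite /disc expr_div_n sqr_sqrtr; last first.
  by apply: addr_ge0; [apply: mulr_ge0|apply: mulr_ge0 (ltW l0);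
    apply: mulr_ge0]; exact: sqr_ge0.
by field; rewrite gt_eqF.
Qed.

Let disc_ge (eps s0 s1 lam : R) : 0 < lam ->
  `|s0 - 2 * eps| <= disc eps s0 s1 lam.
Proof.
move=> l0; have D0 := disc_ge0 eps s0 s1 l0.
rewrite -(ger0_norm D0) -ler_sqr ?nnegrE// !real_normK ?num_real// sqr_disc// lerDl.
by apply: divr_ge0 (ltW l0); apply: mulr_ge0; exact: sqr_ge0.
Qed.

Lemma decayF_le (eps s0 s1 lam : R) : 0 < lam -> decayF eps s0 s1 lam <= eps.
Proof.
move=> l0; rewrite decayFE//; have := disc_ge eps s0 s1 l0.
by rewrite ler_norml => /andP[]; lra.
Qed.

(** With [alpha] the value of [decayF] at [eps], the numbers [eps - alpha] and
    [s0 - eps - alpha] are nonnegative and their product is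
    [eps^2 (s1 - eps)^2 / (4 lam)]. This is what makes the quadratic form
    [(eps - alpha) lam x^2 - eps (s - eps) x y + (s0 - eps - alpha) y^2]
    nonnegative. *)
Lemma decayF_form (eps s s0 s1 lam x y : R) : 0 < lam -> 0 < eps -> eps <= s0 ->
  s0 <= s <= s1 ->
  decayF eps s0 s1 lam * y ^+ 2 - (eps - decayF eps s0 s1 lam) * lam * x ^+ 2 <=
  (s - eps) * y * (y - eps * x).
Proof.
move=> l0 e0 es0 /andP[s0s ss1].
have D2 := sqr_disc eps s0 s1 l0; have DD := disc_ge eps s0 s1 l0.
rewrite decayFE//; set D := disc _ _ _ _ in D2 DD *.
pose a := (eps - (s0 - D) / 2) * lam; pose b := s0 - eps - (s0 - D) / 2.
have a0 : 0 <= a.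
  by rewrite mulr_ge0 ?(ltW l0)//; move: DD; rewrite ler_norml => /andP[]; lra.
have b0 : 0 <= b by rewrite /b; move: DD; rewrite ler_norml => /andP[]; lra.
have ab : 4 * (a * b) = eps ^+ 2 * (s1 - eps) ^+ 2.
  rewrite (_ : 4 * (a * b) = lam * (D ^+ 2 - (s0 - 2 * eps) ^+ 2)).
    by rewrite D2; field; rewrite gt_eqF.
  by rewrite /a /b; field.
have m2 : (- (eps * (s - eps))) ^+ 2 <= 4 * (a * b).
  rewrite ab sqrrN exprMn ler_wpM2l ?sqr_ge0// ler_sqr ?nnegrE; lra.
have := quadratic_form_ge0 x y a0 b0 m2.
have : 0 <= (s - s0) * y ^+ 2 by rewrite mulr_ge0 ?sqr_ge0// subr_ge0.
rewrite /a /b; lra.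
Qed.

Lemma decayF_gt0_eps (eps s0 s1 lam : R) : 0 < lam ->
  0 < decayF eps s0 s1 lam -> 0 < eps < s0.
Proof.
move=> l0; rewrite decayFE// pmulr_lgt0// subr_gt0.
have D0 := disc_ge0 eps s0 s1 l0; have D2 := sqr_disc eps s0 s1 l0.
move: (disc _ _ _ _) D0 D2 => D D0 D2 Ds0.
have s00 : 0 < s0 := le_lt_trans D0 Ds0.
have : D ^+ 2 < s0 ^+ 2 by rewrite ltr_sqr ?nnegrE// ltW.
rewrite D2 => h.
have h2 : (s0 - 2 * eps) ^+ 2 < s0 ^+ 2.
  apply: le_lt_trans h; rewrite lerDl.
  by apply: divr_ge0 (ltW l0); apply: mulr_ge0; exact: sqr_ge0.
by nra.
Qed.

(** For small positive [eps] the radicand is [s0^2 lam^2 - 4 s0 lam^2 eps] up to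
    terms of order [eps^2], so that [decayF] is positive. *)
Lemma decayF_gt0_exists (s0 s1 lam : R) : 0 < lam -> 0 < s0 ->
  exists eps, 0 < decayF eps s0 s1 lam.
Proof.
move=> l0 s00.
pose C := 4 * lam + (`|s1| + 1) ^+ 2.
have C0 : 0 < C by rewrite ltr_wpDr ?sqr_ge0// mulr_gt0.
have sl0 : 0 < s0 * lam by rewrite mulr_gt0.
have Csl : 0 < C + s0 * lam by rewrite addr_gt0.
pose eps := s0 * lam / (C + s0 * lam).
have e0 : 0 < eps by rewrite divr_gt0.
have e1 : eps < 1 by rewrite ltr_pdivrMr// mul1r ltrDr.
have eC : eps * C < s0 * lam.
  have -> : s0 * lam = eps * (C + s0 * lam) by rewrite mulfVK// gt_eqF.
  by rewrite ltr_pM2l// ltrDl.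
exists eps; rewrite decayFE// divr_gt0// subr_gt0.
have D0 := disc_ge0 eps s0 s1 l0; have D2 := sqr_disc eps s0 s1 l0.
rewrite -ltr_sqr ?nnegrE ?(ltW s00)// D2.
rewrite -ltrBrDl ltr_pdivrMr//.
have h1 : (s1 - eps) ^+ 2 <= (`|s1| + 1) ^+ 2.
  rewrite -real_normK ?num_real// ler_sqr ?nnegrE ?addr_ge0//.
  by rewrite (le_trans (ler_normB _ _))// lerD2l ger0_norm ltW.
have h2 : eps * (s1 - eps) ^+ 2 + eps * (4 * lam) < 4 * s0 * lam.
  apply: (@le_lt_trans _ _ (eps * C)).
    by rewrite /C mulrDr addrC lerD2l ler_wpM2l// ltW.
  by apply: lt_trans eC _; nra.
move: h2; rewrite -subr_gt0 -(pmulr_rgt0 _ e0) -subr_gt0 => h2.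
by rewrite -subr_gt0; apply: (lt_le_trans h2); nra.
Qed.

End decay_rate.

(** * Functions on the space-time cylinder *)

Lemma is_derive_oppdir (R : realType) (V : normedModType R) (f : V -> R)
    (z v : V) (l : R) :
  is_derive z v f l -> is_derive z (- v) f (- l).
Proof.
move=> /is_derive_lineP fl; apply/is_derive_lineP.
have -> : (fun t : R => f (t *: - v + z)) =
    (fun t : R => f (t *: v + z)) \o (fun t => - t).
  by apply/funext => t /=; rewrite scalerN scaleNr.
rewrite -[- l]mulrN1; apply: is_derive1_comp.
by rewrite oppr0.
Qed.

Lemma derivative_closure (R : realType) (V : normedModType R) (f g : V -> R)
    (A : set V) (z v : V) (d : R) : 0 < d ->
  {within closure A, continuous f} -> {within closure A, continuous g} ->
  (forall y, A y -> is_derive y v f (g y)) -> closure A z ->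
  (forall y s, A y -> ball z d y -> `|s| <= d -> A (s *: v + y)) ->
  is_derive z v f (g z).
Proof.
move=> d0 cf cg df clz seg.
have c : h^-1 *: (f (h *: v + z) - f z) @[h --> (0:R)^'] --> g z.
  apply: (@cvg_at_right_left_dnbhs _ R^o).
    apply: (right_derivative_closure d0 cf cg df clz) => y s Ay zy /andP[s0 sd].
    by apply: seg; rewrite // ger0_norm.
  apply/cvg_at_leftNP; rewrite oppr0.
  have cgN : {within closure A, continuous (fun y => - g y)}.
    by move=> y; apply: cvgN; exact: cg.
  have := @right_derivative_closure _ _ f (fun y => - g y) A z (- v) d d0 cf cgN.
  move=> /(_ _ clz) H.
  have /cvgN : h^-1 * (f (h *: - v + z) - f z) @[h --> 0^'+] --> - g z.
    apply: H => [y Ay|y s Ay zy /andP[s0 sd]]; first exact/is_derive_oppdir/df.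
    by rewrite scalerN -scaleNr; apply: seg; rewrite // normrN ger0_norm.
  rewrite opprK; apply: cvg_trans; apply: near_eq_cvg; near=> h => /=.
  change (- (h^-1 * (f (h *: - v + z) - f z)) = (- h)^-1 * (f (- h *: v + z) - f z)).
  by rewrite invrN mulNr scalerN scaleNr.
by apply: DeriveDef; [apply/cvg_ex; exists (g z)|exact: cvg_lim c].
Unshelve. all: end_near. Qed.

Section cylinder.
Context {R : realType} {N : nat}.
Variable Omega : set 'rV[R]_N.
Hypothesis oO : open Omega.

Let V := ('rV[R]_N * R)%type.
Implicit Types (F dF : V -> R) (x v : 'rV[R]_N) (t : R).

Lemma open_cylinder : open (cylinder Omega).
Proof.
rewrite openE => -[x t] [/= Ox t0].
exists (Omega, `]0, +oo[%classic) => //=; split; exact: open_nbhs_nbhs.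
Qed.

Lemma closure_cylinder x t : closure Omega x -> 0 <= t ->
  closure (cylinder Omega) (x, t).
Proof.
move=> clx t0 B [[B1 B2] /= [nB1 nB2] BB].
have [y [Oy By]] := clx _ nB1.
have [s [s0 Bs]] : exists s, 0 < s /\ B2 s.
  have /nbhs_ballP[e /= e0 he] := nB2.
  exists (t + e / 2); split; first by rewrite ltr_wpDl// divr_gt0.
  apply: he; rewrite -ball_normE /= opprD addrA subrr sub0r normrN gtr0_norm ?divr_gt0//.
  by rewrite ltr_pdivrMr// ltr_pMr// ltr1n.
exists (y, s); split; last exact: BB.
by split => //=; rewrite in_itv/= andbT.
Qed.

Lemma slice_within F t : 0 <= t -> {within closure (cylinder Omega), continuous F} ->
  {within closure Omega, continuous (fun x => F (x, t))}.
Proof.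
move=> t0 cF.
apply: (@within_continuous_comp _ _ _ (fun x => (x, t)) _ _ F _ _ cF).
  move=> x B [[B1 B2] /= [n1 n2] BB]; apply: filterS n1 => y By.
  by apply: BB; split => //=; exact: nbhs_singleton n2.
by move=> x clx; exact: closure_cylinder.
Qed.

Lemma space_derivative F dF v x t :
  is_derive (x, t) (v, 0) F (dF (x, t)) ->
  is_derive x v (fun y => F (y, t)) (dF (x, t)).
Proof.
move=> dFx; apply: (@is_derive_affine _ _ _ (fun y => (y, t)) v (v, 0)) => // h.
by congr (_, _); rewrite /= scaler0 add0r.
Qed.

Lemma time_derivative F dF x t :
  is_derive (x, t) (0, 1) F (dF (x, t)) ->
  is_derive t 1 (fun s => F (x, s)) (dF (x, t)).
Proof.
move=> dFx; apply: (@is_derive_affine _ _ _ (fun s : R => (x, s)) 1 (0, 1)) => // h.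
by congr (_, _); rewrite /= scaler0 add0r.
Qed.

Variables (F dF : V -> R).
Hypothesis cF : {within closure (cylinder Omega), continuous F}.
Hypothesis cdF : {within closure (cylinder Omega), continuous dF}.

(** At time 0 the space derivatives are the extensions of those at positive
    times. *)
Lemma initial_space_derivative v x :
  (forall z, cylinder Omega z -> is_derive z (v, 0) F (dF z)) ->
  Omega x -> is_derive x v (fun y => F (y, 0)) (dF (x, 0)).
Proof.
move=> FD Ox; apply: space_derivative.
have /nbhs_ballP[r /= r0 hr] := open_nbhs_nbhs (conj oO Ox).
have v1 : 0 < `|v| + 1 by rewrite ltr_wpDl.
apply: (@derivative_closure _ _ F dF (cylinder Omega) (x, 0) (v, 0) (r / (`|v| + 1))) => //.
- by rewrite divr_gt0.
- by apply: closure_cylinder => //; exact: subset_closure.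
move=> [y s] k [/= Oy s0] [/= xy _] kd; split => /=; last by rewrite scaler0 add0r.
apply: hr; rewrite -ball_normE /= opprD addrCA.
rewrite (le_lt_trans (ler_normD _ _))// normrN normrZ.
have -> : r = r / (`|v| + 1) * `|v| + r / (`|v| + 1).
  by rewrite -{2}[r / _]mulr1 -mulrDr mulrVK// unitfE gt_eqF.
apply: ler_ltD; first by rewrite ler_wpM2r.
by move: xy; rewrite -ball_normE.
Qed.

Lemma right_time_derivative x t :
  (forall z, cylinder Omega z -> is_derive z (0, 1) F (dF z)) ->
  closure Omega x -> 0 <= t ->
  (F (x, t + h) - F (x, t)) / h @[h --> 0^'+] --> dF (x, t).
Proof.
move=> FD clx t0.
have := @right_derivative_closure _ _ F dF (cylinder Omega) (x, t) (0, 1) 1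
  ltr01 cF cdF FD (closure_cylinder clx t0).
have seg : forall y s, cylinder Omega y -> ball (x, t) 1 y -> 0 <= s <= 1 ->
    cylinder Omega (s *: (0, 1) + y).
  move=> [y r] s [/= Oy r0] _ /andP[s0 _]; split => /=; first by rewrite scaler0 add0r.
  move: r0; rewrite !in_itv/= !andbT => r0.
  by rewrite [_ *: _]mulr1 ltr_wpDl.
move=> /(_ seg); apply: cvg_trans; apply: near_eq_cvg; near=> h.
rewrite mulrC; congr ((F _ - _) * _).
by congr (_, _); rewrite /= ?scaler0 ?add0r// [_ *: _]mulr1 addrC.
Unshelve. all: end_near. Qed.

(** The time derivative of a function that vanishes on the lateral boundary
    vanishes there too. *)
Lemma lateral_time_derivative x t :
  (forall z, cylinder Omega z -> is_derive z (0, 1) F (dF z)) ->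
  closure Omega x -> 0 <= t -> (forall s, 0 <= s -> F (x, s) = 0) ->
  dF (x, t) = 0.
Proof.
move=> FD clx t0 F0.
have c := right_time_derivative FD clx t0.
have c0 : (F (x, t + h) - F (x, t)) / h @[h --> 0^'+] --> (0 : R).
  have cc : (fun=> 0 : R) h @[h --> (0 : R)^'+] --> (0 : R) by exact: cvg_cst.
  apply: cvg_trans cc; apply: near_eq_cvg; near=> h.
  have h0 : 0 < h by near: h; exact: nbhs_right_gt.
  by rewrite (F0 t)// (F0 (t + h)) ?subrr ?mul0r// addr_ge0// ltW.
exact: (cvg_unique _ c c0).
Unshelve. all: end_near. Qed.

End cylinder.

(** * Decay of the perturbed energy *)

(** The density of the perturbed energy, the squared norm of the gradient of [U]
    plus the square of [U_t + eps U], where [G a] stands for the derivative of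
    [U] along the space-time direction [a]. *)
Definition energy_density (R : realType) (N : nat) (U : 'rV[R]_N * R -> R)
    (G : 'rV[R]_N * R -> 'rV[R]_N * R -> R) (eps : R) (z : 'rV[R]_N * R) : R :=
  \sum_(i < N) G (delta_mx ord0 i, 0) z ^+ 2 + (G (0, 1) z + eps * U z) ^+ 2.

(** The functions [G] and [H] are the first and second derivatives of the
    solution [U], continuous on the closed cylinder; [H a b] is the derivative
    of [G a] along [b]. *)
Section energy.
Context {R : realType} {N : nat}.
Variable Omega : set 'rV[R]_N.
Hypotheses (oO : open Omega) (bO : bounded_set Omega).

Local Notation V := ('rV[R]_N * R)%type.
Local Notation cyl := (cylinder Omega).

Variables (U : V -> R) (G : V -> V -> R) (H : V -> V -> V -> R).
Hypothesis cU : {within closure cyl, continuous U}.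
Hypothesis cG : forall a, {within closure cyl, continuous (G a)}.
Hypothesis cH : forall a b, {within closure cyl, continuous (H a b)}.
Hypothesis UD : forall a z, cyl z -> is_derive z a U (G a z).
Hypothesis GD : forall a b z, cyl z -> is_derive z b (G a) (H a b z).
Hypothesis U0 : forall x t, closure Omega x -> ~ Omega x -> 0 <= t -> U (x, t) = 0.

Variables (sigma : V -> R) (lambda s0 s1 eps : R).
Hypotheses (lambda0 : 0 < lambda) (plambda : poincare Omega lambda).
Hypothesis sigma_bounds : forall z, cyl z -> s0 <= sigma z <= s1.
Hypotheses (eps0 : 0 < eps) (epss0 : eps <= s0).

Local Notation e_ i := ((delta_mx ord0 i, 0) : V).
Local Notation et := ((0, 1) : V).

Hypothesis damped_wave : forall z, cyl z ->
  H et et z - \sum_(i < N) H (e_ i) (e_ i) z + sigma z * G et z = 0.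

Local Notation alpha := (decayF eps s0 s1 lambda).
Local Notation mu := (lebesgue_rV (R := R) N).
Let mO : measurable Omega := open_measurable_rV oO.
Let sO : Omega `<=` closure Omega := @subset_closure _ Omega.

(* The divergence [\sum_(i < N) dflux i] collects the terms of the time
   derivative [ddens] of the energy density that integrate to 0. *)
Let vel z := G et z + eps * U z.
Local Notation dens := (energy_density U G eps).
Let ddens z := \sum_(i < N) 2 * (G (e_ i) z * H (e_ i) et z) +
  2 * (vel z * (H et et z + eps * G et z)).
Let flux i z := vel z * G (e_ i) z.
Let dflux i z := vel z * H (e_ i) (e_ i) z +
  G (e_ i) z * (H et (e_ i) z + eps * G (e_ i) z).

Let cvel : {within closure cyl, continuous vel}.
Proof. by apply: within_continuousD => //; exact: within_continuousZ. Qed.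

Let cdens : {within closure cyl, continuous dens}.
Proof.
apply: within_continuousD; last exact: within_continuousX.
by apply: within_continuous_sum => i; exact: within_continuousX.
Qed.

Let cddens : {within closure cyl, continuous ddens}.
Proof.
apply: within_continuousD.
  by apply: within_continuous_sum => i; apply: within_continuousZ; exact: within_continuousM.
apply: within_continuousZ; apply: within_continuousM => //.
by apply: within_continuousD => //; exact: within_continuousZ.
Qed.

Let cflux i : {within closure cyl, continuous (flux i)}.
Proof. exact: within_continuousM. Qed.

Let cdflux i : {within closure cyl, continuous (dflux i)}.
Proof.
apply: within_continuousD; first exact: within_continuousM.
apply: within_continuousM => //.
by apply: within_continuousD => //; exact: within_continuousZ.
Qed.

Let velD a z : cyl z -> is_derive z a vel (H et a z + eps * G a z).
Proof.
move=> zc; have h1 := GD et a zc; have h2 := UD a zc.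
exact: (@is_deriveD _ _ _ (G et) (eps \*: U)).
Qed.

Let fluxD i z : cyl z -> is_derive z (e_ i) (flux i) (dflux i z).
Proof.
move=> zc; have h1 := velD (e_ i) zc; have h2 := GD (e_ i) (e_ i) zc.
exact: (@is_deriveM _ _ vel (G (e_ i))).
Qed.

Let densD z : cyl z -> is_derive z et dens (ddens z).
Proof.
move=> zc; have h1 := velD et zc; have h2 i := GD (e_ i) et zc.
have -> : dens = \sum_(i < N) (G (e_ i) ^+ 2) + vel ^+ 2.
  by apply/funext => y; rewrite fctE fct_sumE.
have -> : ddens z = \sum_(i < N) (2 * G (e_ i) z ^+ 1) *: H (e_ i) et z +
    (2 * vel z ^+ 1) *: (H et et z + eps * G et z).
  rewrite /ddens; congr (_ + _); last by rewrite expr1 /GRing.scale/= mulrA.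
  by apply: eq_bigr => i _; rewrite expr1 /GRing.scale/= mulrA.
exact: is_deriveD.
Qed.

Let slice (F : V -> R) t : 0 <= t -> {within closure cyl, continuous F} ->
  mu.-integrable Omega (EFin \o (fun x => F (x, t))).
Proof. by move=> t0 cF; apply: integrable_rV_closure => //; exact: slice_within. Qed.

Let strip_bounded (F : V -> R) (T : R) : {within closure cyl, continuous F} ->
  exists2 M, 0 <= M & forall x t, Omega x -> 0 <= t <= T -> `|F (x, t)| <= M.
Proof.
move=> cF.
have cK : compact (closure Omega `*` `[0, T]).
  by apply: compact_setX; [exact: compact_closure_rV|exact: segment_compact].
have sK : closure Omega `*` `[0, T] `<=` closure cyl.
  by move=> [x t] [/= clx]; rewrite in_itv/= => /andP[t0 _]; exact: closure_cylinder.
have [M M0 hM] := within_continuous_compact_bounded cK (continuous_subspaceW sK cF).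
exists M => // x t Ox tT; apply: hM; split => /=; first exact: sO.
by rewrite in_itv/=.
Qed.

(* The absolute value extends the energy continuously to negative times. *)
Let E (t : R) : R := \int[mu]_(x in Omega) dens (x, `|t|).

Let continuous_E : continuous E.
Proof.
move=> t; set T := `|t| + 1.
have [M M0 hM] := strip_bounded T cdens.
have tT : t \in `](- T), T[%classic.
  by rewrite inE/= in_itv/= -ltr_norml /T ltrDl.
apply: (@continuity_under_integral _ _ _ mu (fun t x => dens (x, `|t|)) Omega mO
  (- T) T _ _ (cst M)) tT.
- by move=> s _; apply: slice.
- apply: aeW => x Ox s _.
  have : continuous (dens \o (fun s : R => (x, `|s|))).
    apply/continuous_subspace_setT.
    apply: (@within_continuous_comp _ _ _ (fun s : R => (x, `|s|)) _ _ dens _ _ cdens).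
      move=> r B [[B1 B2] /= [n1 n2] BB].
      have nn : nbhs r ((fun s : R => `|s|) @^-1` B2) by exact: norm_continuous n2.
      apply: filterS nn => q Bq.
      by apply: BB; split => //=; exact: nbhs_singleton n1.
    by move=> r _ /=; apply: closure_cylinder => //; exact: sO.
  exact.
- by apply: (integrable_rV_bounded (M := `|M|)).
- move=> s; rewrite /= in_itv/= -ltr_norml => sT; apply: aeW => x Ox.
  by apply: hM => //; rewrite normr_ge0 ltW.
Qed.

(* The derivative passes under the integral because [ddens] is bounded on
   bounded time intervals. *)
Let E_derivative (t : R) : 0 < t ->
  is_derive t 1 E (\int[mu]_(x in Omega) ddens (x, t)).
Proof.
move=> t0.
have [M M0 hM] := strip_bounded (2 * t) cddens.
have It : `](t / 2), (2 * t)[%classic t.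
  by rewrite /= in_itv/=; apply/andP; split; lra.
have D s x : `](t / 2), (2 * t)[%classic s -> Omega x ->
    is_derive s 1 (fun r => dens (x, `|r|)) (ddens (x, s)).
  rewrite /= in_itv/= => /andP[ts _] Ox.
  have sp : 0 < s by lra.
  apply: (@near_eq_is_derive _ _ _ (fun r => dens (x, r))).
    by near=> r; rewrite gtr0_norm//; near: r; exact: lt_nbhsr.
  apply: time_derivative; apply: densD; split => //=.
  by rewrite in_itv/= sp.
have D' s x : `](t / 2), (2 * t)[%classic s -> Omega x ->
    partial1of2 (fun (s : R) x => dens (x, `|s|)) s x = ddens (x, s).
  by move=> Is Ox; rewrite partial1of2E; have [_ ->] := D s x Is Ox.
have intf s : `](t / 2), (2 * t)[%classic s ->
    mu.-integrable Omega (EFin \o (fun x => dens (x, `|s|))).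
  by move=> _; apply: slice.
have derf s x : `](t / 2), (2 * t)[%classic s -> Omega x ->
    derivable (fun s => dens (x, `|s|)) s 1.
  by move=> Is Ox; have [] := D s x Is Ox.
have M0' (x : 'rV[R]_N) : 0 <= cst M x by [].
have iM : mu.-integrable Omega (EFin \o cst M).
  by apply: (integrable_rV_bounded (M := `|M|)).
have Gub s x : `](t / 2), (2 * t)[%classic s -> Omega x ->
    `|partial1of2 (fun (s : R) x => dens (x, `|s|)) s x| <= cst M x.
  move=> Is Ox; rewrite D'//; apply: hM => //.
  by move: Is; rewrite /= in_itv/= => /andP[? ?]; apply/andP; split; lra.
apply: DeriveDef.
  exact: (derivable_under_integral mO It intf derf M0' iM Gub).
rewrite -derive1E (differentiation_under_integral mO It intf derf M0' iM Gub).
by apply: eq_Rintegral => x; rewrite inE => Ox; exact: D'.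
Unshelve. all: end_near. Qed.

Let continuous_cyl (F : V -> R) z : {within closure cyl, continuous F} -> cyl z ->
  {for z, continuous F}.
Proof.
move=> cF zc.
have : {within cyl, continuous F} by apply: continuous_subspaceW cF; exact: subset_closure.
rewrite continuous_open_subspace; first by apply; exact: mem_set.
exact: open_cylinder.
Qed.

Let H_sym a b z : cyl z -> H a b z = H b a z.
Proof.
move=> zc; exact: (@schwarz _ _ U (G a) (G b) (H a b) (H b a) cyl z a b
  (open_cylinder oO) zc (@UD a) (@UD b) (@GD a b) (@GD b a)
  (@continuous_cyl (H a b) z (@cH a b) zc) (@continuous_cyl (H b a) z (@cH b a) zc)).
Qed.

Let vel_lateral x t : closure Omega x -> ~ Omega x -> 0 <= t -> vel (x, t) = 0.
Proof.
move=> clx nOx t0; rewrite /vel U0// mulr0 addr0.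
exact: (lateral_time_derivative cU (@cG et) (@UD et) clx t0
  (fun s s0' => U0 clx nOx s0')).
Qed.

Let cyl_pair x t : Omega x -> 0 < t -> cyl (x, t).
Proof. by move=> Ox t0; split => //=; rewrite in_itv/= t0. Qed.

Let integral_dflux i t : 0 < t -> \int[mu]_(x in Omega) dflux i (x, t) = 0.
Proof.
move=> t0; rewrite /Rintegral.
rewrite (@integral_vanishing_primitive _ _ i _ (fun x => flux i (x, t)))//; split => //.
- by apply: slice_within => //; exact: ltW.
- by apply: slice_within => //; exact: ltW.
split=> [x Ox|x clx nOx].
  by apply: space_derivative; apply: fluxD; exact: cyl_pair.
by rewrite /flux vel_lateral ?mul0r// ltW.
Qed.

Let poincare_slice t : 0 < t ->
  lambda * \int[mu]_(x in Omega) (U (x, t) ^+ 2) <=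
  \int[mu]_(x in Omega) (\sum_(i < N) G (e_ i) (x, t) ^+ 2).
Proof.
move=> t0; have t0' := ltW t0.
apply: (@poincare_C1 _ _ _ _ oO bO (fun x => U (x, t)) (fun v x => G (v, 0) (x, t))) => //.
- exact: slice_within.
- by move=> v x Ox; apply: space_derivative; apply: UD; exact: cyl_pair.
- by move=> v; exact: slice_within.
- by move=> x clx nOx; exact: U0.
Qed.

Let rest z := ddens z - 2 * \sum_(i < N) dflux i z.

(* The wave equation and the symmetry of second derivatives reduce the
   remaining terms to the quadratic form of [decayF_form]. *)
Let rest_le z : cyl z ->
  rest z <= - (2 * eps) * \sum_(i < N) G (e_ i) z ^+ 2 +
    (- (2 * alpha) * vel z ^+ 2 + 2 * (eps - alpha) * lambda * U z ^+ 2).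
Proof.
move=> zc.
have -> : rest z = - (2 * eps) * \sum_(i < N) G (e_ i) z ^+ 2 -
    2 * ((sigma z - eps) * vel z * (vel z - eps * U z)).
  have -> : vel z - eps * U z = G et z by rewrite /vel addrK.
  have -> : (sigma z - eps) * vel z * G et z = vel z * (sigma z * G et z) -
     eps * vel z * G et z by ring.
  have -> : sigma z * G et z = \sum_(i < N) H (e_ i) (e_ i) z - H et et z.
    by have := damped_wave zc; lra.
  rewrite /rest /ddens /dflux.
  have -> : \sum_(i < N) 2 * (G (e_ i) z * H (e_ i) et z) =
      2 * \sum_(i < N) G (e_ i) z * H et (e_ i) z.
    by rewrite mulr_sumr; apply: eq_bigr => i _; rewrite (H_sym _ et zc).
  have -> : \sum_(i < N) (vel z * H (e_ i) (e_ i) z +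
      G (e_ i) z * (H et (e_ i) z + eps * G (e_ i) z)) =
      vel z * \sum_(i < N) H (e_ i) (e_ i) z +
      (\sum_(i < N) G (e_ i) z * H et (e_ i) z +
       eps * \sum_(i < N) G (e_ i) z ^+ 2).
    rewrite !mulr_sumr -!big_split/=; apply: eq_bigr => i _; ring.
  ring.
have := decayF_form (U z) (vel z) lambda0 eps0 epss0 (sigma_bounds zc).
lra.
Qed.

Let E_derivative_le t : 0 < t ->
  \int[mu]_(x in Omega) ddens (x, t) <= - (2 * alpha) * E t.
Proof.
move=> t0; have t0' := ltW t0.
have iG2 : mu.-integrable Omega (EFin \o (fun x => \sum_(i < N) G (e_ i) (x, t) ^+ 2)).
  apply: (@slice (fun z => \sum_(i < N) G (e_ i) z ^+ 2)) => //.
  by apply: within_continuous_sum => i; exact: within_continuousX.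
have iv2 : mu.-integrable Omega (EFin \o (fun x => vel (x, t) ^+ 2)).
  by apply: (@slice (fun z => vel z ^+ 2)) => //; exact: within_continuousX.
have iU2 : mu.-integrable Omega (EFin \o (fun x => U (x, t) ^+ 2)).
  by apply: (@slice (fun z => U z ^+ 2)) => //; exact: within_continuousX.
have csum : {within closure cyl, continuous (fun z => 2 * \sum_(i < N) dflux i z)}.
  by apply: within_continuousZ; exact: within_continuous_sum.
have irest : mu.-integrable Omega (EFin \o (fun x => rest (x, t))).
  by apply: (@slice rest) => //; exact: within_continuousB.
have isum := slice t0' csum.
have idf i := slice t0' (@cdflux i).
have E1 : \int[mu]_(x in Omega) ddens (x, t) = \int[mu]_(x in Omega) rest (x, t).
  rewrite -[RHS]addr0.
  have <- : \int[mu]_(x in Omega) (2 * \sum_(i < N) dflux i (x, t)) = 0.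
    have isum1 : mu.-integrable Omega (EFin \o (fun x => \sum_(i < N) dflux i (x, t))).
      by apply: (@slice (fun z => \sum_(i < N) dflux i z)) => //; exact: within_continuous_sum.
    rewrite RintegralZl// /Rintegral; under eq_integral do rewrite -sumEFin.
    rewrite integral_sum//= big1 ?mulr0// => i _.
    by rewrite -(fineK (integrable_fin_num mO (idf i))) [fine _]integral_dflux.
  rewrite -RintegralD//; apply: eq_Rintegral => x _.
  by rewrite /rest subrK.
have E2 : E t = \int[mu]_(x in Omega) (\sum_(i < N) G (e_ i) (x, t) ^+ 2) +
    \int[mu]_(x in Omega) (vel (x, t) ^+ 2).
  by rewrite -RintegralD// /E (ger0_norm t0').
rewrite E1 E2.
have integrableZ (f : 'rV[R]_N -> R) (k : R) : mu.-integrable Omega (EFin \o f) ->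
    mu.-integrable Omega (EFin \o (fun x => k * f x)).
  by move=> fi; apply: (integrableZl mO k fi).
have integrableDD (f g : 'rV[R]_N -> R) : mu.-integrable Omega (EFin \o f) ->
    mu.-integrable Omega (EFin \o g) ->
    mu.-integrable Omega (EFin \o (fun x => f x + g x)).
  by move=> fi gi; apply: (integrableD mO fi gi).
have /= I1 := integrableZ _ (- (2 * eps)) iG2.
have /= I2 := integrableZ _ (- (2 * alpha)) iv2.
have /= I3 := integrableZ _ (2 * (eps - alpha) * lambda) iU2.
have /= I23 := integrableDD _ _ I2 I3.
apply: (@le_trans _ _ (\int[mu]_(x in Omega)
   (- (2 * eps) * \sum_(i < N) G (e_ i) (x, t) ^+ 2 +
    (- (2 * alpha) * vel (x, t) ^+ 2 + 2 * (eps - alpha) * lambda * U (x, t) ^+ 2)))).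
  apply: le_Rintegral => //; first exact: integrableDD.
  by move=> x Ox; apply: rest_le; exact: cyl_pair.
rewrite RintegralD// RintegralD// !RintegralZl//.
(* The coefficient of the integral of [U^2] is nonnegative, so the Poincare
   inequality absorbs it in the gradient term. *)
have := poincare_slice t0.
have : 0 <= eps - alpha by rewrite subr_ge0; exact: decayF_le.
move=> h1 h2; have := mulr_ge0 h1 (etrans (subr_ge0 _ _) h2); lra.
Qed.

Lemma energy_decay (t : R) : 0 <= t ->
  \int[mu]_(x in Omega) dens (x, t) <=
  \int[mu]_(x in Omega) dens (x, 0) * expR (- 2 * alpha * t).
Proof.
move=> t0.
suff : E t <= E 0 * expR (- 2 * alpha * t) by rewrite /E normr0 (ger0_norm t0).
pose Phi (s : R) : R := E s * expR (2 * alpha * s).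
have eD (s : R) : is_derive s 1 (fun s => expR (2 * alpha * s))
    (expR (2 * alpha * s) * (2 * alpha)).
  apply: (@is_derive1_comp _ expR (fun s => 2 * alpha * s)).
  have := @is_deriveZ _ _ _ id (2 * alpha) s 1 1 (is_derive_id _ _).
  by rewrite [_ *: 1]mulr1.
have PhiD (s : R) : 0 < s -> is_derive s 1 Phi (E s *: (expR (2 * alpha * s) * (2 * alpha)) +
    expR (2 * alpha * s) *: \int[mu]_(x in Omega) ddens (x, s)).
  by move=> s0'; have h := E_derivative s0'; exact: (@is_deriveM _ _ E _).
have : Phi t <= Phi 0.
  apply: (@ler0_derive1_nincr _ Phi 0 t) => //.
  - by move=> s; rewrite in_itv/= => /andP[s0' _]; have [] := PhiD s s0'.
  - move=> s; rewrite in_itv/= => /andP[s0' _].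
    rewrite derive1E; have [_ ->] := PhiD s s0'.
    have := E_derivative_le s0'; have := expR_gt0 (2 * alpha * s).
    rewrite /GRing.scale/=; nra.
  - apply: continuous_subspaceT => s; apply: cvgM; first exact: continuous_E.
    by have [/derivable1_diffP/differentiable_continuous] := eD s.
rewrite /Phi mulr0 expR0 mulr1.
have -> : - 2 * alpha * t = - (2 * alpha * t) by ring.
by rewrite expRN ler_pdivlMr// expR_gt0.
Qed.

End energy.

(** * The damped wave equation *)

(** The first derivatives [g] and second derivatives [h] of a function of class
    C^2 up to the boundary, extended to the closure and chosen as functions of
    the directions. *)
Lemma Ck_closure2_derivatives (R : realType) (V : normedModType R) (A : set V)
    (f : V -> R) : Ck_closure 2 A f ->
  exists (g : V -> V -> R) (h : V -> V -> V -> R),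
    [/\ {within closure A, continuous f},
        forall a, {within closure A, continuous (g a)},
        forall a b, {within closure A, continuous (h a b)},
        forall a z, A z -> is_derive z a f (g a z) &
        forall a b z, A z -> is_derive z b (g a) (h a b z)].
Proof.
move=> [cf df].
have /choice[g hg] : forall a, exists g : V -> R,
    (forall z, A z -> is_derive z a f (g z)) /\ Ck_closure 1 A g.
  by move=> a; have [g ? ?] := df a; exists g.
have /choice[h hh] : forall a, exists h : V -> V -> R, forall b,
    (forall z, A z -> is_derive z b (g a) (h b z)) /\ Ck_closure 0 A (h b).
  move=> a; have [_ [_ dg]] := hg a.
  have /choice[h hh] : forall b, exists h : V -> R,
      (forall z, A z -> is_derive z b (g a) (h z)) /\ Ck_closure 0 A h.
    by move=> b; have [h ? ?] := dg b; exists h.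
  by exists h.
exists g, h; split => //.
- by move=> a; have [_ []] := hg a.
- by move=> a b; have [_ []] := hh a b.
- by move=> a; have [] := hg a.
- by move=> a b; have [] := hh a b.
Qed.

Lemma near_derive1 (R : realType) (f g : R -> R) (t : R) :
  (\near t, f t = g t) -> derive1 f t = derive1 g t.
Proof. by move=> fg; rewrite !derive1E; exact: near_eq_derive. Qed.

Theorem mainTheorem1 (R : realType) (N : nat) (Omega : set 'rV[R]_N)
    (lambda1 : R)
    (sigma : 'rV[R]_N -> R -> R) (sigma0 sigma1 : R)
    (u : 'rV[R]_N -> R -> R) (u0 u1 : 'rV[R]_N -> R)
    (eps_star alpha_star : R) :
  (0 < N)%N ->
  open Omega ->
  bounded_set Omega ->
  0 < lambda1 ->
  first_eigenvalue Omega lambda1 ->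
  {within cylinder Omega, continuous (fun z => sigma z.1 z.2)} ->
  0 < sigma0 ->
  (forall (x : 'rV[R]_N) (t : R), Omega x -> 0 < t -> sigma0 <= sigma x t <= sigma1) ->
  sigma0 = inf [set sigma z.1 z.2 | z in cylinder Omega] ->
  sigma1 = sup [set sigma z.1 z.2 | z in cylinder Omega] ->
  Ck_closure 2 (cylinder Omega) (fun z => u z.1 z.2) ->
  (forall (x : 'rV[R]_N) (t : R), Omega x -> 0 < t ->
     derive1n 2 (u x) t - laplacian (fun y => u y t) x + sigma x t * derive1 (u x) t = 0) ->
  (forall (x : 'rV[R]_N) (t : R), boundary Omega x -> 0 <= t -> u x t = 0) ->
  (forall x : 'rV[R]_N, Omega x -> u x 0 = u0 x) ->
  (forall x : 'rV[R]_N, Omega x -> (u x h - u x 0) / h @[h --> 0^'+] --> u1 x) ->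
  (forall eps, decayF eps sigma0 sigma1 lambda1 <=
               decayF eps_star sigma0 sigma1 lambda1) ->
  alpha_star = decayF eps_star sigma0 sigma1 lambda1 ->
  [/\ 0 < alpha_star,
      forall t : R, 0 <= t ->
        (\int[lebesgue_rV N]_(x in Omega) (gradsq (fun y => u y t) x)%:E <=
         (\int[lebesgue_rV N]_(x in Omega)
            (gradsq u0 x + `|u1 x + eps_star * u0 x| ^+ 2)%:E) *
         (expR (- 2 * alpha_star * t))%:E)%E &
      exists M a : R, 0 < a /\
        forall t : R, 0 <= t ->
          (\int[lebesgue_rV N]_(x in Omega) (gradsq (fun y => u y t) x)%:E <=
           (M * expR (- a * t))%:E)%E].
Proof.
move=> _ oO bO l0 [plam _] _ s00 sb _ _ cku pde ub uinit utinit epsmax ->.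
have mO := open_measurable_rV oO.
have [G [H [cU cG cH UD GD]]] := Ck_closure2_derivatives cku.
set U := (fun z : 'rV[R]_N * R => u z.1 z.2) in cU UD.
pose e_ i : 'rV[R]_N * R := (delta_mx ord0 i, 0).
pose et : 'rV[R]_N * R := (0, 1).
have cyl x t : Omega x -> 0 < t -> cylinder Omega (x, t).
  by move=> Ox t0; split => //=; rewrite in_itv/= t0.
have partial_u i x t : Omega x -> 0 <= t ->
    partial i (fun y => u y t) x = G (e_ i) (x, t).
  rewrite /partial le_eqVlt => Ox /predU1P[<-|t0].
    by have [_] := initial_space_derivative oO cU (@cG (e_ i)) (@UD (e_ i)) Ox.
  by have [_] := space_derivative (UD (e_ i) _ (cyl x t Ox t0)).
have gradsq_u x t : Omega x -> 0 <= t ->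
    gradsq (fun y => u y t) x = \sum_(i < N) G (e_ i) (x, t) ^+ 2.
  by move=> Ox t0; rewrite /gradsq; apply: eq_bigr => i _; rewrite partial_u.
have u_t x t : Omega x -> 0 < t -> derive1 (u x) t = G et (x, t).
  move=> Ox t0; rewrite derive1E.
  by have [_] := time_derivative (UD et _ (cyl x t Ox t0)).
have wave z : cylinder Omega z ->
    H et et z - \sum_(i < N) H (e_ i) (e_ i) z + sigma z.1 z.2 * G et z = 0.
  case: z => x t [/= Ox]; rewrite in_itv/= andbT => t0.
  apply: etrans (pde x t Ox t0); rewrite u_t//; congr (_ - _ + _).
    rewrite /= [RHS](@near_derive1 _ _ (fun s => G et (x, s))); last first.
      near=> s; rewrite u_t//.
      by near: s; exact: lt_nbhsr.
    rewrite derive1E.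
    by have [_ ->] := time_derivative (GD et et _ (cyl x t Ox t0)).
  rewrite /laplacian; apply: eq_bigr => i _; rewrite {1}/partial.
  rewrite [RHS](@near_eq_derive _ _ _ _ (fun y => G (e_ i) (y, t))); last first.
    have := open_nbhs_nbhs (conj oO Ox); apply: filterS => y Oy.
    by apply: partial_u => //; exact: ltW.
  by have [_ ->] := space_derivative (GD (e_ i) (e_ i) _ (cyl x t Ox t0)).
have a0 : 0 < decayF eps_star sigma0 sigma1 lambda1.
  have [eps he] := decayF_gt0_exists sigma1 l0 s00.
  exact: lt_le_trans he (epsmax eps).
have /andP[e0 es] := decayF_gt0_eps l0 a0.
pose D := energy_density U G eps_star.
have U0 x t : closure Omega x -> ~ Omega x -> 0 <= t -> U (x, t) = 0.
  move=> clx nOx t0; apply: ub => //; split => //.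
  by move: oO => /interior_id ->.
have sbz z : cylinder Omega z -> sigma0 <= sigma z.1 z.2 <= sigma1.
  by case: z => x t [/= Ox]; rewrite in_itv/= andbT; exact: sb.
have decay := energy_decay oO bO cU cG cH UD GD U0 l0 plam sbz e0 (ltW es) wave.
have iD t : 0 <= t ->
    (lebesgue_rV N).-integrable Omega (EFin \o (fun x => D (x, t))).
  move=> t0; apply: integrable_rV_closure => //; apply: (@slice_within _ _ _ D) => //.
  apply: within_continuousD.
    by apply: within_continuous_sum => i; exact: within_continuousX.
  apply: within_continuousX; apply: within_continuousD => //.
  exact: within_continuousZ.
have ED t : 0 <= t -> (\int[lebesgue_rV N]_(x in Omega) (D (x, t))%:E =
    (\int[lebesgue_rV N]_(x in Omega) D (x, t))%:E)%E.
  by move=> t0; rewrite /Rintegral fineK//; exact: (integrable_fin_num mO (iD t t0)).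
have main t : 0 <= t ->
    (\int[lebesgue_rV N]_(x in Omega) (gradsq (fun y => u y t) x)%:E <=
     ((\int[lebesgue_rV N]_(x in Omega) D (x, 0)) *
      expR (- 2 * decayF eps_star sigma0 sigma1 lambda1 * t))%:E)%E.
  move=> t0; apply: (@le_trans _ _ (\int[lebesgue_rV N]_(x in Omega) (D (x, t))%:E)%E); last first.
    by rewrite ED// lee_fin; exact: decay.
  rewrite (eq_integral (fun x => (\sum_(i < N) G (e_ i) (x, t) ^+ 2)%:E)); last first.
    by move=> x; rewrite inE => Ox; rewrite gradsq_u.
  have iG : (lebesgue_rV N).-integrable Omega
      (EFin \o (fun x => \sum_(i < N) G (e_ i) (x, t) ^+ 2)).
    apply: integrable_rV_closure => //.
    apply: (@slice_within _ _ _ (fun z => \sum_(i < N) G (e_ i) z ^+ 2)) => //.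
    by apply: within_continuous_sum => i; exact: within_continuousX.
  apply: ge0_le_integral => //.
  - by move=> x _; rewrite lee_fin; apply: sumr_ge0 => i _; exact: sqr_ge0.
  - exact: (measurable_int _ iG).
  - exact: (measurable_int _ (iD t t0)).
  - by move=> x Ox; rewrite lee_fin lerDl sqr_ge0.
have ED0 : (\int[lebesgue_rV N]_(x in Omega)
    (gradsq u0 x + `|u1 x + eps_star * u0 x| ^+ 2)%:E =
    \int[lebesgue_rV N]_(x in Omega) (D (x, 0))%:E)%E.
  apply: eq_integral => x; rewrite inE => Ox.
  have u0E : \forall y \near x, u0 y = u y 0.
    by have := open_nbhs_nbhs (conj oO Ox); apply: filterS => y Oy; rewrite uinit.
  have -> : gradsq u0 x = gradsq (fun y => u y 0) x.
    by rewrite /gradsq; apply: eq_bigr => i _; congr (_ ^+ 2); exact: near_eq_derive.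
  have -> : u1 x = G et (x, 0).
    have clx : closure Omega x by exact: subset_closure.
    have := right_time_derivative cU (@cG et) (@UD et) clx (lexx 0).
    rewrite /U /=; under eq_fun do rewrite add0r.
    move=> c; exact: (cvg_unique _ (utinit x Ox) c).
  by rewrite gradsq_u// -uinit// real_normK ?num_real.
split => //.
- by move=> t t0; apply: (le_trans (main t t0)); rewrite EFinM -ED// ED0.
- exists (\int[lebesgue_rV N]_(x in Omega) D (x, 0)).
  exists (2 * decayF eps_star sigma0 sigma1 lambda1); split; first by rewrite mulr_gt0.
  by move=> t t0; rewrite -mulNr; exact: main.
Unshelve. all: end_near. Qed.
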